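(* Let $a\in(0,\infty)$, $1<p\le q<\infty$, $0<\alpha<d$, and let $(u,v)$ be a pair of weights on $\mathbb{R}^d$. If $$(u,v)\in\bigcup_{b'>6a+9\sqrt d\,a^2}\ \bigcup_{0<\beta'<\alpha}\mathscr{M}_{p,q,\beta'}^{b'},$$ then $\tilde I_\alpha^a$ is bounded from $L^p(\mathbb{R}^d,v,\gamma)$ to $L^q(\mathbb{R}^d,u,\gamma)$; that is, there exists a constant $C>0$ such that for all $f\in L^p(\mathbb{R}^d,v,\gamma)$, $$\left(\int_{\mathbb{R}^d}\big|\tilde I_\alpha^a(f)(x)\big|^q u(x)\,d\gamma(x)\right)^{1/q}\le C\left(\int_{\mathbb{R}^d}|f(x)|^p v(x)\,d\gamma(x)\right)^{1/p}.$$
   Context: $\gamma$ is the Gaussian probability measure on $\mathbb{R}^d$, $d\gamma(x)=\pi^{-d/2}e^{-|x|^2}\,dx$, with $|\cdot|$ the Euclidean norm. A weight is a locally integrable function on $\mathbb{R}^d$ that is nonnegative $\gamma$-almost everywhere. $L^p(\mathbb{R}^d,v,\gamma)$ is the space of measurable $f$ with $\int_{\mathbb{R}^d}|f|^p v\,d\gamma<\infty$. All cubes $Q\subset\mathbb{R}^d$ have sides parallel to the coordinate axes; $c_Q$ is the center and $\ell(Q)$ the side length of $Q$; $Q(x,r)$ denotes the cube with center $x$ and side length $r$. Put $m(x)=\min\{1,1/|x|\}$ (with $m(0)=1$), and for $b>0$ put $\mathscr{Q}_b=\{Q\subset\mathbb{R}^d \text{ cube}:\ \ell(Q)\le b\,m(c_Q)\}$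 and $\mathscr{Q}_b(x)=\{Q\in\mathscr{Q}_b: x\in Q\}$. The local fractional integral operator with cubes is $$\tilde I_\alpha^a(f)(x)=\int_{Q(x,\,a\,m(x))}\frac{f(y)}{[\gamma(Q(x,|x-y|))]^{1-\alpha/d}}\,d\gamma(y),$$ where at points $x$ at which the integral is not absolutely convergent the value is counted as $+\infty$. For $b>0$ and $0\le\beta<d$ the local fractional maximal operator is $$M_\beta^b(f)(x)=\sup_{Q\in\mathscr{Q}_b(x)}\frac{1}{\gamma(Q)^{1-\beta/d}}\int_Q|f(y)|\,d\gamma(y).$$ Local-$b$ testing condition: with $p'=p/(p-1)$, $(u,v)\in\mathscr{M}_{p,q,\beta}^b$ means $$\sup_{Q\in\mathscr{Q}_b}\left[\int_Q\big(M_\beta^b(v^{1-p'}\chi_Q)(x)\big)^q u(x)\,d\gamma(x)\right]^{1/q}\left(\int_Q v(x)^{1-p'}\,d\gamma(x)\right)^{-1/p}<\infty .$$ Conventions: in integrands $0\cdot\infty=0$; if for some $Q$ both the first bracket and $\int_Q v^{1-p'}d\gamma$ are infinite, the product is counted as $+\infty$ (so the condition fails). *)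

(* Defs.v *)
From HB Require Import structures.
From mathcomp Require Import all_boot all_order all_algebra.
From mathcomp Require Import all_classical all_reals all_analysis.
From mathcomp Require Import measurable_realfun.
Import Order.TTheory GRing.Theory Num.Theory.
Import numFieldNormedType.Exports.
Set Implicit Arguments.
Unset Strict Implicit.
Unset Printing Implicit Defensive.
Local Open Scope classical_set_scope.
Local Open Scope ring_scope.

(* R^d is the type of d-tuples of reals with the product of the Borel
   sigma-algebras. *)
Notation Rvec R d := (d.-tuple (measurableTypeR R)).

(* The library has no Lebesgue measure in dimension d: it is built by iterating
   the binary product with [lebesgue_measure], starting from the Dirac mass on
   the one-point space R^0. *)
Section lebesgue_step.
Local Open Scope ereal_scope.
Context {R : realType} (n : nat).

Definition tcons (x : measurableTypeR R * Rvec R n) : Rvec R n.+1 :=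
  [tuple of x.1 :: x.2].

Lemma measurable_tcons : measurable_fun setT tcons.
Proof. exact: (measurable_cons measurable_fst measurable_snd). Qed.

Variable mu : {sigma_finite_measure set (Rvec R n) -> \bar R}.

Definition lebesgue_step : set (Rvec R n.+1) -> \bar R :=
  pushforward (@lebesgue_measure R \x mu) tcons.

Let nu : {measure set (Rvec R n.+1) -> \bar R} :=
  measure_function_pushforward__canonical__measure_function_Measure
    (product_measure1 (@lebesgue_measure R) mu) measurable_tcons.

Let step0 : lebesgue_step set0 = 0. Proof. exact: (measure0 nu). Qed.

Let step_ge0 A : 0 <= lebesgue_step A. Proof. exact: (measure_ge0 nu). Qed.

Let step_sigma_additive : semi_sigma_additive lebesgue_step.
Proof. exact: (@measure_semi_sigma_additive _ _ _ nu). Qed.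

HB.instance Definition _ := isMeasure.Build _ _ _ lebesgue_step
  step0 step_ge0 step_sigma_additive.

Let step_sigma_finite : sigma_finite setT lebesgue_step.
Proof.
have /sigma_finiteP[F [TF ndF Foo]] := sigma_finiteT (@lebesgue_measure R).
have /sigma_finiteP[G [TG ndG Goo]] := sigma_finiteT mu.
pose g (y : Rvec R n.+1) : measurableTypeR R * Rvec R n :=
  (tnth y ord0, [tuple of behead y]).
have mg : measurable_fun setT g.
  apply/measurable_fun_pairP; split.
    exact: measurable_tnth.
  exact: measurable_behead.
have gK x : g (tcons x) = x.
  by case: x => a b; rewrite /g/=; congr pair; exact/val_inj.
exists (fun k => g @^-1` (F k `*` G k)).
  rewrite predeqE => y; split=> // _.
  have [k1 _ Fk] : (\bigcup_k F k) (g y).1 by rewrite -TF.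
  have [k2 _ Gk] : (\bigcup_k G k) (g y).2 by rewrite -TG.
  exists (maxn k1 k2) => //; split.
    by move: Fk; exact/subsetPset/ndF/leq_maxl.
  by move: Gk; exact/subsetPset/ndG/leq_maxr.
move=> k; have [mF Fk] := Foo k; have [mG Gk] := Goo k; split.
  by rewrite -[X in measurable X]setTI; apply: mg => //; exact: measurableX.
rewrite /lebesgue_step /pushforward -comp_preimage.
rewrite (_ : g \o tcons = id); last exact/funext.
by rewrite preimage_id product_measure1E// lte_mul_pinfty// ge0_fin_numE.
Qed.

HB.instance Definition _ := Measure_isSigmaFinite.Build _ _ _ lebesgue_step
  step_sigma_finite.

Definition lebesgue_step_measure :
  {sigma_finite_measure set (Rvec R n.+1) -> \bar R} := lebesgue_step.

End lebesgue_step.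

Fixpoint lebesgue_Rvec (R : realType) (d : nat) :
    {sigma_finite_measure set (Rvec R d) -> \bar R} :=
  if d is d'.+1 then lebesgue_step_measure (lebesgue_Rvec R d')
  else \d_([tuple] : Rvec R 0).

Lemma lebesgue_Rvec_box (R : realType) (d : nat)
    (A : 'I_d -> set (measurableTypeR R)) : (forall i, measurable (A i)) ->
  (lebesgue_Rvec R d [set x | forall i, A i (tnth x i)] =
   \prod_(i < d) lebesgue_measure (A i))%E.
Proof.
elim: d => [|d IH] in A * => mA.
  rewrite big_ord0 /= diracE mem_set//.
  by case.
rewrite big_ord_recl /= /lebesgue_step /pushforward.
rewrite (_ : _ @^-1` _ =
  A ord0 `*` [set x | forall i, A (lift ord0 i) (tnth x i)]).
  rewrite product_measure1E//.
    by rewrite (IH (fun i => A (lift ord0 i))).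
  rewrite (_ : mkset _ =
      \bigcap_(i in [set: 'I_d]) ((@tnth _ _)^~ i @^-1` A (lift ord0 i))).
    apply: fin_bigcap_measurable => // i _.
    by rewrite -[X in measurable X]setTI; exact: measurable_tnth.
  by rewrite predeqE => x; split=> [h i _|h i]; exact: h.
rewrite predeqE => -[t x]; split => /= h.
  split; first exact: (h ord0).
  by move=> i; have := h (lift ord0 i); rewrite tnthS.
case: h => h0 h1 i; case: (unliftP ord0 i) => [j|] ->//.
by rewrite tnthS.
Qed.

Section gauss.
Local Open Scope ereal_scope.
Context {R : realType}.

Definition enorm d (x : Rvec R d) : R :=
  Num.sqrt (\sum_(i < d) (tnth x i : R) ^+ 2)%R.

Definition edist d (x y : Rvec R d) : R :=
  Num.sqrt (\sum_(i < d) ((tnth x i : R) - tnth y i) ^+ 2)%R.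

Definition gauss_density d (x : Rvec R d) : R :=
  (pi `^ (- (d%:R / 2)) * expR (- enorm x ^+ 2))%R.

Lemma gauss_density_ge0 d (x : Rvec R d) : (0 <= gauss_density x)%R.
Proof. by rewrite mulr_ge0// ?powR_ge0// expR_ge0. Qed.

Lemma measurable_gauss_density d :
  measurable_fun setT (@gauss_density d : Rvec R d -> R).
Proof.
apply: measurable_funM => //; apply: measurableT_comp => //.
rewrite (_ : (fun x => _) =
    fun x : Rvec R d => (- \sum_(i < d) (tnth x i : R) ^+ 2)%R); last first.
  apply/funext => x; rewrite /enorm sqr_sqrtr//.
  by apply: sumr_ge0 => i _; exact: sqr_ge0.
apply: measurableT_comp => //; apply: measurable_sum => i.
by apply: measurable_funX; exact: measurable_tnth.
Qed.

Variable d : nat.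

Definition gauss : set (Rvec R d) -> \bar R :=
  fun A => \int[lebesgue_Rvec R d]_(x in A) (gauss_density x)%:E.

Let gauss0 : gauss set0 = 0. Proof. exact: integral_set0. Qed.

Let gauss_ge0 A : 0 <= gauss A.
Proof. by apply: integral_ge0 => x _; rewrite lee_fin gauss_density_ge0. Qed.

Let gauss_sigma_additive : semi_sigma_additive gauss.
Proof.
move=> A mA tA mUA; rewrite /gauss ge0_integral_bigcup//; last 2 first.
- apply/measurable_EFinP; apply: measurable_funTS.
  exact: measurable_gauss_density.
- by move=> x _; rewrite lee_fin gauss_density_ge0.
by apply: is_cvg_ereal_nneg_natsum_cond => n _ _; exact: gauss_ge0.
Qed.

HB.instance Definition _ := isMeasure.Build _ _ _ gauss
  gauss0 gauss_ge0 gauss_sigma_additive.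

End gauss.

Notation gauss_measure R d :=
  (@gauss R d : {measure set (Rvec R d) -> \bar R}).

Section operators.
Local Open Scope ereal_scope.
Context {R : realType} {d : nat}.
Implicit Types (x y c : Rvec R d) (Q : set (Rvec R d)).

Local Notation gamma := (gauss_measure R d).

(* Lebesgue measurability, the library's sigma-algebra being only the Borel one.
   On a Lebesgue measurable function the library integral, a supremum over Borel
   simple functions below it, agrees with the integral for the completed
   measure. *)
Definition lebesgue_measurable_fun (f : Rvec R d -> R) : Prop :=
  forall B : set (measurableTypeR R), measurable B ->
    completed_algebra_gen (lebesgue_Rvec R d) (f @^-1` B).

(* The topology of R^d is taken from row vectors, as tuples carry none. *)
Definition locally_integrable_fun (f : Rvec R d -> R) : Prop :=
  lebesgue_measurable_fun f /\
  forall K : set 'rV[R]_d, compact K ->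
    \int[lebesgue_Rvec R d]_(x in [set x | K (\row_i (tnth x i : R))])
      `|f x|%:E < +oo.

Definition weight (w : Rvec R d -> R) : Prop :=
  locally_integrable_fun w /\ {ae gamma, forall x, (0 <= w x)%R}.

Definition Lp_integral (p : R) (v f : Rvec R d -> R) : \bar R :=
  \int[gamma]_x (`|f x| `^ p * v x)%:E.

Definition Lp_weighted (p : R) (v : Rvec R d -> R) : set (Rvec R d -> R) :=
  [set f | lebesgue_measurable_fun f /\ Lp_integral p v f < +oo].

Definition cube c (r : R) : set (Rvec R d) :=
  [set y | forall i, (`|(tnth y i : R) - tnth c i| <= r / 2)%R].

Definition admissible x : R :=
  if enorm x == 0%R then 1%R else Num.min 1%R (enorm x)^-1%R.

Definition local_cubes (b : R) : set (set (Rvec R d)) :=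
  [set Q | exists c r, [/\ (0 < r)%R, (r <= b * admissible c)%R & Q = cube c r]].

Definition local_fractional_integral (alpha a : R) (f : Rvec R d -> R) x :
    \bar R :=
  let Q := cube x (a * admissible x)%R in
  let k y := (f y)%:E / gamma (cube x (edist x y)) `^ (1 - alpha / d%:R) in
  if \int[gamma]_(y in Q) `|k y| < +oo then \int[gamma]_(y in Q) k y else +oo.

Definition local_fractional_maximal (beta b : R) (f : Rvec R d -> \bar R) x :
    \bar R :=
  ereal_sup [set (gamma Q `^ (1 - beta / d%:R))^-1 * \int[gamma]_(y in Q) `|f y|
            | Q in [set Q | local_cubes b Q /\ Q x]].

(* v ^ (1 - p'), with p' = p / (p - 1); the exponent is negative, so the value
   is +oo where v vanishes, whereas [powR] would give 0 there. *)
Definition dual_weight (p : R) (v : Rvec R d -> R) x : \bar R :=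
  if v x == 0%R then +oo else (v x `^ (1 - p / (p - 1)))%:E.

(* [(B `^ p^-1)^-1] is B ^ (-1/p) with (+oo) ^ (-1/p) = 0, which [poweR] does
   not provide for negative exponents. *)
Definition testing_quotient (p q beta b : R) (u v : Rvec R d -> R) Q : \bar R :=
  let A := \int[gamma]_(x in Q)
    (local_fractional_maximal beta b
       (fun y => dual_weight p v y * (\1_Q y)%:E) x `^ q * (u x)%:E) in
  let B := \int[gamma]_(x in Q) dual_weight p v x in
  if (A == +oo) && (B == +oo) then +oo else A `^ q^-1 * (B `^ p^-1)^-1.

Definition local_testing (p q beta b : R) (u v : Rvec R d -> R) : Prop :=
  ereal_sup [set testing_quotient p q beta b u v Q | Q in local_cubes b] < +oo.

End operators.

(* Main.v *)
From HB Require Import structures.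
Require Import Defs.
From mathcomp Require Import all_boot all_order all_algebra.
From mathcomp Require Import all_classical all_reals all_analysis.
From mathcomp Require Import measurable_realfun ring lra zify.
Import Order.TTheory GRing.Theory Num.Theory.

(** The fractional integral of order [alpha] is dominated by the maximal
    function of the smaller order [beta'], and the testing condition makes the
    latter bounded, as in Sawyer's theorem.

    Cells. Two distinct points whose distance [s] in the supremum norm is at most
    a third of the coarsest side lie in a common cell of side at most [6 s] of
    one of [2 ^ d] dyadic grids, obtained by translating each coordinate by [0]
    or by a third of the coarsest side (one-third trick, [common_cell]). On the
    cube of side [a m(x)] around [x] this produces cells of side at most
    [3 a m(x)], whose closures are admissible for the parameter [b']
    ([cube_local]); on such cubes the density of the Gaussian measure is
    constant up to a bounded factor, and the measure is doubling
    ([gauss_cube_doubling]).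

    Domination. If the side of a common cell of [x] and [y] is comparable with
    their distance, the kernel at [(x, y)] is at most a constant times
    [g ^ (beta' / d - 1)] times [side ^ (alpha - beta')], where [g] is the
    Gaussian measure of the cell. The last factor is summable over the
    generations, so that the fractional integral at [x] is at most a constant
    times the supremum, over the cells of [x], of [g ^ (beta' / d - 1)] times
    the integral of [|f|] over the cell ([local_fractional_integral_le]).

    Two weights. The cells of one grid are laminar: two of them are nested or
    disjoint. For a maximal function over a laminar family, Sawyer's theorem
    follows from the Carleson embedding: the sets where a given cell realizes
    the maximum are disjoint, the testing condition on a cell bounds the total
    mass of those below it, and an embedding theorem for the averages with
    respect to the dual weight sums up the contributions ([laminar_two_weight],
    [carleson_embedding]). The embedding itself is a statement on decreasing
    sequences of reals, proved by summation by parts ([carleson_sum_le]). The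
    function [f], the weight [v] and the dual weight [s = v ^ (1 - p')] are
    related only through the pointwise inequality
    [|f| <= c s + c ^ (1 - p) |f| ^ p v], valid for all [c > 0]
    ([cut_fun_split]).

    Degenerate cells. Where the dual weight has infinite mass on a cell, the
    testing condition forces [u] to vanish almost everywhere on that cell
    ([testing_infinite]), and the cell can be ignored.

    The functions [u], [v], [f] are replaced by Borel versions, which changes
    them on null sets only. The maximal function of the testing condition, a
    supremum over uncountably many cubes, is compared with Borel functions by
    the monotonicity of the integral on arbitrary functions
    ([le_integral_ae]). *)

Set Implicit Arguments.
Unset Strict Implicit.
Unset Printing Implicit Defensive.
Local Open Scope classical_set_scope.
Local Open Scope ring_scope.

(** * Summation by parts and sums along decreasing levels *)

Section real_sequences.
Context {R : realType}.
Implicit Types (p t K H : R) (n : nat).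

(** Convexity of the power function, obtained from Young's inequality for
    [y * x `^ (t - 1)]. *)
Lemma powR_sub_le (x y t : R) : 0 <= y -> y <= x -> 1 <= t ->
  x `^ t - y `^ t <= t * x `^ (t - 1) * (x - y).
Proof.
move=> y0 yx t1; have x0 := le_trans y0 yx.
have t0 : 0 < t by exact: lt_le_trans t1.
have [->|tn1] := eqVneq t 1.
  by rewrite subrr powRr0 !powRr1// !mul1r.
have {}t1 : 0 < t - 1 by rewrite subr_gt0 lt_neqAle eq_sym tn1.
have young := @conjugate_powR R y (x `^ (t - 1)) t (t / (t - 1)) y0
  (powR_ge0 _ _) t0.
rewrite divr_gt0// in young; have {}young := young isT.
rewrite -powRrM (_ : (t - 1) * _ = t) in young; last by field; lra.
have e : t^-1 + (t / (t - 1))^-1 = 1 by field; rewrite gt_eqF//=; lra.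
have := young e.
rewrite -(ler_pM2r t0) mulrDl divfK ?gt_eqF//.
rewrite (_ : x `^ t / _ * t = (t - 1) * x `^ t); last first.
  by field; rewrite gt_eqF//=; lra.
have := mulr_powRB1 x0 t0.
by nra.
Qed.

Lemma abel_summation n (a B : nat -> R) :
  \sum_(0 <= i < n) a i * B i =
  \sum_(0 <= i < n) (B i - B i.+1) * (\sum_(0 <= j < i.+1) a j)
  + B n * \sum_(0 <= j < n) a j.
Proof.
elim: n => [|n IH]; first by rewrite !big_geq// mulr0 addr0.
rewrite big_nat_recr//= IH [in RHS]big_nat_recr//=.
rewrite [X in _ = _ + _ + B n.+1 * X]big_nat_recr//=.
by rewrite [X in _ = _ + _ * X + _]big_nat_recr//=; ring.
Qed.

(** The strong type inequality of the dyadic maximal function on a decreasing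
    enumeration of its levels. Here [A i] is the value of the maximal function
    on the [i]-th of a sequence of disjoint pieces, and [s], [phi], [h] are the
    masses of the piece for the measure, the function and its [p]-th power. The
    hypothesis relating partial sums is the weak type inequality. Summation by
    parts turns it into [Z <= q * sum of phi * A ^ (p - 1)], where
    [q = p / (p - 1)] and [Z] is the left-hand side. The splitting of [phi] with
    a parameter proportional to [A i] bounds the last sum by [Z / (2 q)] plus a
    multiple of [H], so that [Z] is absorbed. *)
Lemma maximal_sum_le p n H (A s phi h : nat -> R) : 1 < p ->
    (forall i, 0 <= A i.+1 <= A i) -> A n = 0 -> (forall i, 0 <= s i) ->
    (forall i, (i < n)%N -> A i * (\sum_(0 <= j < i.+1) s j)
                            <= \sum_(0 <= j < i.+1) phi j) ->
    (forall i c, (i < n)%N -> 0 < c -> phi i <= c * s i + c `^ (1 - p) * h i) ->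
    (forall i, 0 <= h i) -> \sum_(0 <= i < n) h i <= H ->
  \sum_(0 <= i < n) s i * A i `^ p <= (2 * (p / (p - 1))) `^ p * H.
Proof.
move=> p1 Ad An s0 wt fsh h0 hH.
have p0 : 0 < p by exact: lt_trans p1.
have p10 : 0 < p - 1 by lra.
have A0 i : 0 <= A i by have /andP[/le_trans] := Ad i; apply.
have [q qE] : exists q, q = p / (p - 1) by exists (p / (p - 1)).
rewrite -qE.
have q1 : 1 <= q by rewrite qE ler_pdivlMr//; lra.
have q0 : 0 < q by exact: lt_le_trans q1.
set Z := \sum_(0 <= i < n) _.
have key : Z <= q * \sum_(0 <= i < n) phi i * A i `^ (p - 1).
  rewrite /Z (abel_summation _ s) (abel_summation _ phi) An !powR0 ?gt_eqF//.
  rewrite !mul0r !addr0 mulr_sumr.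
  apply: ler_sum_nat => i /andP[_ iin]; have /andP[Ai0 Aii] := Ad i.
  have := @powR_sub_le (A i `^ (p - 1)) (A i.+1 `^ (p - 1)) q (powR_ge0 _ _).
  rewrite ge0_ler_powR ?nnegrE ?(ltW p10)// => /(_ isT q1).
  rewrite -!powRrM (_ : (p - 1) * q = p); last by rewrite qE; field; lra.
  rewrite (_ : (p - 1) * (q - 1) = 1); last by rewrite qE; field; lra.
  rewrite powRr1//.
  have S_ge0 : 0 <= \sum_(0 <= j < i.+1) s j by exact: sumr_ge0.
  set X := A i `^ (p - 1) - _.
  have X0 : 0 <= X by rewrite subr_ge0 ge0_ler_powR ?nnegrE// ltW.
  move=> dif; apply: (le_trans (ler_wpM2r S_ge0 dif)).
  rewrite (_ : q * A i * X * _ =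
    q * (X * (A i * \sum_(0 <= j < i.+1) s j))); last by ring.
  by apply: ler_wpM2l; [exact: ltW|apply: ler_wpM2l => //; exact: wt].
(* with this parameter the splitting returns exactly half of [Z] *)
pose c := (2 * q)^-1.
have c0 : 0 < c by rewrite invr_gt0 mulr_gt0.
have absorb : \sum_(0 <= i < n) phi i * A i `^ (p - 1)
    <= c * Z + c `^ (1 - p) * H.
  apply: (@le_trans _ _ (\sum_(0 <= i < n) (c * (s i * A i `^ p)
                                            + c `^ (1 - p) * h i))).
    apply: ler_sum_nat => i /andP[_ iin].
    have := A0 i; rewrite le_eqVlt => /predU1P[<-|Ai0].
      rewrite !powR0 ?gt_eqF// !mulr0 add0r.
      by rewrite mulr_ge0 ?powR_ge0.
    apply: (le_trans (ler_wpM2r (powR_ge0 _ _) (fsh i (c * A i) iin _))).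
      exact: mulr_gt0.
    rewrite powRM ?(ltW c0)// -(mulr_powRB1 (ltW Ai0) p0).
    have -> : 1 - p = - (p - 1) by ring.
    rewrite !powRN le_eqVlt; apply/orP; left; apply/eqP; field.
    by rewrite !gt_eqF ?powR_gt0.
  rewrite big_split/= -!mulr_sumr lerD2l ler_wpM2l ?powR_ge0//.
have eqc : q * c = 2^-1 by rewrite /c; field; rewrite gt_eqF.
have : Z <= 2 * q * (c `^ (1 - p) * H).
  have := ler_wpM2l (ltW q0) absorb; rewrite mulrDr [q * (c * Z)]mulrA eqc.
  by move: key; lra.
rewrite mulrA /c -powR_inv1; last by rewrite mulr_ge0// ltW.
rewrite -powRrM (_ : -1 * (1 - p) = p - 1); last by ring.
by rewrite mulr_powRB1// mulr_ge0// ltW.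
Qed.

(** The Carleson embedding inequality on a decreasing enumeration. For [t = 1]
    summation by parts replaces the partial sums of [a] by those of [s] and
    reduces the claim to the maximal inequality. For [t > 1] the surplus power
    [t - 1] of the partial sums of [s] is paid for by the weak type bound
    [weak] in the proof, against the surplus power of [A] that [powR_sub_le]
    produces. *)
Lemma carleson_sum_le p t n K H (A a s phi h : nat -> R) : 1 < p -> 1 <= t ->
    (forall i, 0 <= A i.+1 <= A i) -> A n = 0 -> (forall i, 0 <= s i) ->
    0 <= K ->
    (forall i, (i < n)%N -> \sum_(0 <= j < i.+1) a j
                            <= K * (\sum_(0 <= j < i.+1) s j) `^ t) ->
    (forall i, (i < n)%N -> A i * (\sum_(0 <= j < i.+1) s j)
                            <= \sum_(0 <= j < i.+1) phi j) ->
    (forall i c, (i < n)%N -> 0 < c -> phi i <= c * s i + c `^ (1 - p) * h i) ->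
    (forall i, 0 <= h i) -> \sum_(0 <= i < n) h i <= H ->
  \sum_(0 <= i < n) a i * A i `^ (p * t) <=
  K * (t * (2 `^ p) `^ (t - 1) * (2 * (p / (p - 1))) `^ p) * H `^ t.
Proof.
move=> p1 t1 Ad An s0 K0 carl wt fsh h0 hH.
have p0 : 0 < p by exact: lt_trans p1.
have t0 : 0 < t by exact: lt_le_trans t1.
have H0 : 0 <= H by apply: le_trans hH; exact: sumr_ge0.
have A0 i : 0 <= A i by have /andP[/le_trans] := Ad i; apply.
have weak i : (i < n)%N -> A i `^ p * (\sum_(0 <= j < i.+1) s j) <= 2 `^ p * H.
  move=> iin; set S := \sum_(0 <= j < i.+1) s j.
  have := A0 i; rewrite le_eqVlt => /predU1P[<-|Ai0].
    by rewrite powR0 ?gt_eqF// mul0r mulr_ge0 ?powR_ge0.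
  pose c := A i / 2; have c0 : 0 < c by rewrite divr_gt0.
  have : A i * S <= c * S + c `^ (1 - p) * H.
    apply: (le_trans (wt _ iin)).
    apply: (@le_trans _ _ (\sum_(0 <= j < i.+1) (c * s j + c `^ (1 - p) * h j))).
      apply: ler_sum_nat => j /andP[_ ji]; apply: fsh => //.
      exact: leq_trans ji _.
    rewrite big_split/= -!mulr_sumr lerD2l ler_wpM2l ?powR_ge0//.
    apply: le_trans hH; rewrite (@big_cat_nat _ _ _ i.+1 0 n)//= lerDl.
    exact: sumr_ge0.
  have -> : A i * S = 2 * (c * S) by rewrite /c; field.
  rewrite -lerBlDl (_ : 2 * _ - _ = c * S); last by ring.
  rewrite -(ler_pM2r (powR_gt0 (p - 1) c0)) (_ : 1 - p = - (p - 1)); last by ring.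
  rewrite powRN mulrAC mulr_powRB1// ?(ltW c0)//.
  rewrite -mulrA mulrCA [X in _ <= H * X]mulVf ?gt_eqF ?powR_gt0// mulr1.
  rewrite /c powRM ?(ltW Ai0)// -powR_inv1// -powRrM mulN1r powRN.
  by rewrite mulrAC ler_pdivrMr ?powR_gt0// [leRHS]mulrC.
rewrite (eq_bigr (fun i => a i * (A i `^ p) `^ t)); last first.
  by move=> i _; rewrite powRrM.
rewrite abel_summation An (@powR0 _ p) ?gt_eqF// (@powR0 _ t) ?gt_eqF//.
rewrite mul0r addr0.
pose W := \sum_(0 <= i < n)
  (A i `^ p - A i.+1 `^ p) * (\sum_(0 <= j < i.+1) s j).
have WH : W <= (2 * (p / (p - 1))) `^ p * H.
  have := maximal_sum_le p1 Ad An s0 wt fsh h0 hH.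
  by rewrite abel_summation An powR0 ?gt_eqF// mul0r addr0.
apply: (@le_trans _ _ (K * (t * (2 `^ p * H) `^ (t - 1)) * W)); last first.
  rewrite powRM ?powR_ge0// -(mulr_powRB1 H0 t0).
  have : 0 <= K * (t * ((2 `^ p) `^ (t - 1) * H `^ (t - 1))).
    by rewrite !mulr_ge0 ?powR_ge0// ltW.
  move=> c0; apply: (le_trans (ler_wpM2l c0 WH)).
  by rewrite le_eqVlt; apply/orP; left; apply/eqP; ring.
rewrite /W mulr_sumr; apply: ler_sum_nat => i /andP[_ iin].
have /andP[Ai0 Aii] := Ad i.
have AA : A i.+1 `^ p <= A i `^ p by rewrite ge0_ler_powR ?nnegrE// ltW.
set S := \sum_(0 <= j < i.+1) s j.
have S0 : 0 <= S by exact: sumr_ge0.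
set X := A i `^ p in AA *; set Y := A i.+1 `^ p in AA *.
have X0 : 0 <= X by exact: powR_ge0.
have dif := powR_sub_le (powR_ge0 _ _ : 0 <= Y) AA t1.
have XY0 : 0 <= X `^ t - Y `^ t.
  by rewrite subr_ge0 ge0_ler_powR ?nnegrE ?powR_ge0 ?(ltW t0).
apply: (le_trans (ler_wpM2l XY0 (carl _ iin))); rewrite -/S.
apply: (le_trans (ler_wpM2r _ dif)); first by rewrite mulr_ge0 ?powR_ge0.
rewrite -(mulr_powRB1 S0 t0).
have XS : (X * S) `^ (t - 1) <= (2 `^ p * H) `^ (t - 1).
  rewrite ge0_ler_powR ?subr_ge0 ?nnegrE ?mulr_ge0 ?powR_ge0//.
  exact: weak.
rewrite powRM// in XS.
have c0 : 0 <= K * t * (X - Y) * S.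
  by rewrite !mulr_ge0 ?subr_ge0 ?(ltW t0).
by move: (ler_wpM2l c0 XS); lra.
Qed.

End real_sequences.

(** * The Carleson embedding for laminar families *)

Lemma powR_sum_ge (R : realType) (I : Type) (r : seq I) (x : I -> R) (t : R) :
  1 <= t -> (forall i, 0 <= x i) ->
  \sum_(i <- r) x i `^ t <= (\sum_(i <- r) x i) `^ t.
Proof.
move=> t1 x0; have t0 : 0 < t by exact: lt_le_trans t1.
elim: r => [|i r IH]; first by rewrite !big_nil powR_ge0.
rewrite !big_cons; apply: (le_trans (lerD (lexx _) IH)).
set y := \sum_(_ <- _) _; have y0 : 0 <= y by exact: sumr_ge0.
have xy0 : 0 <= x i + y by rewrite addr_ge0.
rewrite -(mulr_powRB1 xy0 t0) -(mulr_powRB1 (x0 i) t0) -(mulr_powRB1 y0 t0).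
rewrite mulrDl lerD// ler_wpM2l// ge0_ler_powR ?subr_ge0 ?nnegrE//.
- by rewrite lerDl.
- by rewrite lerDr.
Qed.

Definition laminar (I T : Type) (Q : I -> set T) :=
  forall i j, [\/ Q i `<=` Q j, Q j `<=` Q i | Q i `&` Q j = set0].

(** Both inequalities between sums over a laminar family and measures of unions
    that the Carleson embedding requires are checked on the maximal members,
    which are disjoint and have the same union. *)
Lemma laminar_maximal (T : Type) (Q : nat -> set T) (n : nat) : laminar Q ->
  exists M : seq nat, [/\ uniq M, {in M, forall j, (j < n)%N},
    trivIset [set` M] Q &
    forall i, (i < n)%N -> exists2 j, j \in M & Q i `<=` Q j].
Proof.
move=> lam; elim: n => [|n [M [uM Mn tM cM]]]; first by exists [::].
have [[j jM nj]|nsub] := pselect (exists2 j, j \in M & Q n `<=` Q j).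
  exists M; split=> // [i /Mn/ltnW//|i].
  by rewrite ltnS leq_eqVlt => /predU1P[->|/cM//]; exists j.
exists (n :: [seq j <- M | ~~ `[< Q j `<=` Q n >]]); split.
- rewrite /= filter_uniq// andbT mem_filter negb_and; apply/orP; right.
  by apply/negP => /Mn; rewrite ltnn.
- move=> j; rewrite inE => /predU1P[->//|]; rewrite mem_filter => /andP[_ /Mn].
  exact: ltnW.
- have disj j : j \in [seq j <- M | ~~ `[< Q j `<=` Q n >]] -> Q j `&` Q n = set0.
    rewrite mem_filter => /andP[/asboolPn nsub' jM].
    by case: (lam j n) => // s; case: nsub; exists j.
  move=> i j; rewrite /= !inE => /predU1P[->|iM] /predU1P[->|jM]//.
  + by rewrite setIC disj// => -[].
  + by rewrite disj// => -[].
  + by apply: tM; rewrite /=; [move: iM|move: jM]; rewrite mem_filter => /andP[].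
- move=> i; rewrite ltnS leq_eqVlt => /predU1P[->|/cM[j jM ij]].
    by exists n; rewrite ?inE ?eqxx.
  have [jn|jn] := pselect (Q j `<=` Q n).
    by exists n; rewrite ?inE ?eqxx//; exact: subset_trans jn.
  by exists j => //; rewrite inE mem_filter jM asboolF// orbT.
Qed.

Lemma measure_bigcup_seq d (T : measurableType d) (R : realType)
    (mu : {measure set T -> \bar R}) (I : choiceType) (M : seq I) (Q : I -> set T) :
    (forall i, measurable (Q i)) -> uniq M -> trivIset [set` M] Q ->
  (mu (\bigcup_(k in [set` M]) Q k) = \sum_(k <- M) mu (Q k))%E.
Proof.
by move=> mQ uM tM; rewrite measure_fin_bigcup// (fsbig_seq _ _ uM).
Qed.

Section carleson.
Context d (T : measurableType d) (R : realType).
Variables (sg ph et : {measure set T -> \bar R}).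
Variables (p t K H : R).
Hypotheses (p1 : 1 < p) (t1 : 1 <= t) (K0 : 0 <= K).
Hypothesis phse : forall A, measurable A -> forall c, 0 < c ->
  (ph A <= c%:E * sg A + (c `^ (1 - p))%:E * et A)%E.
Hypothesis etH : (et setT <= H%:E)%E.

Let etfin A : measurable A -> et A \is a fin_num.
Proof.
move=> mA; rewrite ge0_fin_numE//; apply: le_lt_trans (ltry H).
by apply: le_trans etH; rewrite le_measure ?inE.
Qed.

Let phfin A : measurable A -> (sg A < +oo)%E -> ph A \is a fin_num.
Proof.
move=> mA sA; rewrite ge0_fin_numE//; apply: (le_lt_trans (phse mA ltr01)).
rewrite lte_add_pinfty// lte_mul_pinfty// ?lee_fin ?powR_ge0//.
by rewrite ltey_eq etfin.
Qed.

Let ave (Q : nat -> set T) i := fine (ph (Q i)) / fine (sg (Q i)).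

Let carleson_sorted (Q : nat -> set T) (a : nat -> R) (n : nat) :
    (forall i, measurable (Q i)) -> laminar Q -> (forall i, (sg (Q i) < +oo)%E) ->
    (forall i j, (i <= j < n)%N -> ave Q j <= ave Q i) ->
    (forall i, 0 <= a i) ->
    (forall i, (i < n)%N ->
      \sum_(0 <= j < n | `[< Q j `<=` Q i >]) a j <= K * fine (sg (Q i)) `^ t) ->
  \sum_(0 <= j < n) a j * ave Q j `^ (p * t) <=
  K * (t * (2 `^ p) `^ (t - 1) * (2 * (p / (p - 1))) `^ p) * H `^ t.
Proof.
move=> mQ lam sQ srt a0 carl.
have ave0 i : 0 <= ave Q i by rewrite divr_ge0// fine_ge0.
pose A i := if (i < n)%N then ave Q i else 0.
have maximal m : exists M : seq nat, [/\ uniq M, {in M, forall j, (j < m)%N},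
    trivIset [set` M] Q,
    forall i, (i < m)%N -> exists2 j, j \in M & Q i `<=` Q j &
    \big[setU/set0]_(k < m) Q k = \bigcup_(k in [set` M]) Q k].
  have [M [uM Mm tM cM]] := laminar_maximal m lam; exists M; split => //.
  rewrite -bigcup_mkord; apply/seteqP; split=> x [k /= km Qkx].
    by have [j jM] := cM _ km; move=> /(_ _ Qkx); exists j.
  by exists k => //; exact: Mm.
have mD := seqDU_measurable mQ.
have mU m : measurable (\big[setU/set0]_(i < m) Q i).
  exact: bigsetU_measurable.
have sub_sum (mu : {measure set T -> \bar R}) m :
    (forall i, mu (seqDU Q i) \is a fin_num) ->
    \sum_(0 <= j < m) fine (mu (seqDU Q j)) =
    fine (mu (\big[setU/set0]_(i < m) Q i)).
  move=> fmu; rewrite sum_fine; last by move=> i _; exact: fmu.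
  rewrite big_mkord bigsetU_seqDU measure_bigsetU//; exact: trivIset_seqDU.
have DQ i : seqDU Q i `<=` Q i by exact: subDsetl.
have sD i : (sg (seqDU Q i) < +oo)%E.
  by apply: le_lt_trans (sQ i); rewrite le_measure ?inE.
have fsD i : sg (seqDU Q i) \is a fin_num by rewrite ge0_fin_numE.
have fpD i : ph (seqDU Q i) \is a fin_num by exact: phfin.
have feD i : et (seqDU Q i) \is a fin_num by exact: etfin.
rewrite (_ : \sum_(0 <= _ < _) _ =
    \sum_(0 <= i < n) a i * A i `^ (p * t)); last first.
  by apply: eq_big_nat => i /andP[_ iin]; rewrite /A iin.
apply: (@carleson_sum_le _ p t n K H A a (fun i => fine (sg (seqDU Q i)))
  (fun i => fine (ph (seqDU Q i))) (fun i => fine (et (seqDU Q i)))) => //.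
- move=> i; rewrite /A; case: (ltnP i.+1 n) => iin.
    by rewrite (ltn_trans _ iin)// ave0/= srt// leqnSn.
  by rewrite lexx/=; case: ifP.
- by rewrite /A ltnn.
- move=> i iin; rewrite sub_sum//.
  have [M [uM Mi tM cM UM]] := maximal i.+1; rewrite UM.
  rewrite measure_bigcup_seq// -sum_fine; last first.
    by move=> j _; rewrite ge0_fin_numE.
  apply: le_trans (ler_wpM2l K0 (powR_sum_ge _ t1 _)); last first.
    by move=> j; rewrite fine_ge0.
  rewrite mulr_sumr.
  apply: (@le_trans _ _
    (\sum_(k <- M) \sum_(0 <= j < n | `[< Q j `<=` Q k >]) a j)); last first.
    rewrite big_seq [leRHS]big_seq; apply: ler_sum => k /Mi ki; apply: carl.
    exact: leq_trans ki _.
  under [leRHS]eq_bigr do rewrite big_mkcond.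
  rewrite exchange_big/= (@big_cat_nat _ _ _ i.+1 0 n)//=.
  apply: (@le_trans _ _ (\sum_(0 <= j < i.+1)
    \sum_(k <- M) (if `[< Q j `<=` Q k >] then a j else 0))); last first.
    by rewrite lerDl; apply: sumr_ge0 => j _; apply: sumr_ge0 => k _; case: ifP.
  apply: ler_sum_nat => j /andP[_ /cM[k kM jk]].
  rewrite (big_rem k)//= asboolT// lerDl.
  by apply: sumr_ge0 => l _; case: ifP.
- move=> i iin; rewrite !sub_sum// /A iin.
  have [M [uM Mi tM _ ->]] := maximal i.+1.
  rewrite !measure_bigcup_seq// -!sum_fine; last 2 first.
  - by move=> j _; exact: phfin.
  - by move=> j _; rewrite ge0_fin_numE.
  rewrite mulr_sumr big_seq [leRHS]big_seq; apply: ler_sum => k /Mi ki.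
  apply: (@le_trans _ _ (ave Q k * fine (sg (Q k)))).
    by rewrite ler_wpM2r ?fine_ge0// srt// iin -ltnS ki.
  rewrite /ave; have [->|s0] := eqVneq (fine (sg (Q k))) 0.
    by rewrite mulr0 fine_ge0.
  by rewrite divfK.
- move=> i c _ c0; rewrite -lee_fin EFinD !EFinM !fineK//; exact: phse.
- rewrite sub_sum// -lee_fin fineK; last exact: etfin.
  by apply: le_trans etH; rewrite le_measure ?inE.
Qed.

(** If the masses [a] that sit below each member [Q i] add up to at most
    [K * sg (Q i) `^ t], then they integrate the [p t]-th powers of the averages
    of a function at the cost of the [t]-th power of its [p]-norm. The function
    enters only through the measure [ph] that it defines and through [et],
    which stands for its [p]-th power: the splitting [phse] is what remains of
    Hoelder's inequality. Sorting the averages in decreasing order and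
    disjointifying the members puts the family in the form treated by
    [carleson_sum_le]. *)
Theorem carleson_embedding (Q : nat -> set T) (a : nat -> R) (n : nat) :
    (forall i, measurable (Q i)) -> laminar Q -> (forall i, (sg (Q i) < +oo)%E) ->
    (forall i, 0 <= a i) ->
    (forall i, (i < n)%N ->
      \sum_(0 <= j < n | `[< Q j `<=` Q i >]) a j <= K * fine (sg (Q i)) `^ t) ->
  \sum_(0 <= j < n) a j * (fine (ph (Q j)) / fine (sg (Q j))) `^ (p * t) <=
  K * (t * (2 `^ p) `^ (t - 1) * (2 * (p / (p - 1))) `^ p) * H `^ t.
Proof.
move=> mQ lam sQ a0 carl.
pose r := sort (fun i j => ave Q j <= ave Q i) (iota 0 n).
have pr : perm_eq (index_iota 0 n) r.
  by rewrite perm_sym /index_iota subn0 /r perm_sort.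
have szr : size r = n by rewrite size_sort size_iota.
pose g k := nth 0%N r k.
have reindex (P : pred nat) (F : nat -> R) :
    \sum_(0 <= j < n | P j) F j = \sum_(0 <= k < n | P (g k)) F (g k).
  by rewrite (perm_big _ pr)/= (big_nth 0%N) szr.
have gn k : (k < n)%N -> (g k < n)%N.
  move=> kn; have : g k \in r by apply: mem_nth; rewrite szr.
  by rewrite -(perm_mem pr) mem_index_iota.
rewrite reindex.
apply: (@carleson_sorted (Q \o g) (a \o g) n) => //=.
- by move=> i j; exact: lam.
- move=> i j /andP[ij jn].
  apply: (@sorted_leq_nth _ (fun i j => ave Q j <= ave Q i) _ _ 0%N r) => //.
  + by move=> x y z yx xz; exact: le_trans xz yx.
  + by apply: sort_sorted => x y; exact: le_total.
  + by rewrite inE szr (leq_ltn_trans ij jn).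
  + by rewrite inE szr.
- move=> i iin; rewrite -(reindex (fun j => `[< Q j `<=` Q (g i) >]))//.
  exact/carl/gn.
Qed.

End carleson.

(** * Integrals of arbitrary functions and measures with a density *)

Section lower_integral.
Context d (T : measurableType d) (R : realType) (mu : {measure set T -> \bar R}).
Local Open Scope ereal_scope.
Import HBNNSimple.

(** The integral of a nonnegative function is a supremum over the simple
    functions below it, and a simple function can be set to zero on a null set
    without changing its integral. This makes the comparison valid for arbitrary
    functions, such as maximal functions and functions that are only Lebesgue
    measurable. *)
Lemma le_integral_ae (D : set T) (f g : T -> \bar R) :
  {ae mu, forall x, D x -> f x <= g x} ->
  \int[mu]_(x in D) f x <= \int[mu]_(x in D) g x.
Proof.
suff nn (h k : T -> \bar R) : {ae mu, forall x, h x <= k x} ->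
    (forall x, 0 <= k x) ->
    ereal_sup [set sintegral mu e | e in
      [set e : {nnsfun T >-> R} | forall x, (e x)%:E <= h x]] <=
    ereal_sup [set sintegral mu e | e in
      [set e : {nnsfun T >-> R} | forall x, (e x)%:E <= k x]].
  move=> fg; rewrite /integral; apply: leeB; apply: nn => //.
  - apply: filterS fg => x fg; rewrite !funeposE /patch.
    by case: ifPn => [/set_mem/fg h|_]//; rewrite ge_max !le_max h lexx/= orbT.
  - apply: filterS fg => x fg; rewrite !funenegE /patch.
    case: ifPn => [/set_mem/fg h|_]//.
    by rewrite ge_max !le_max leeN2 h lexx/= orbT.
move=> [N [mN N0 hkN]] k0; apply: ge_ereal_sup => _ [e eh <-].
have [e' e'E] : exists e' : {nnsfun T >-> R},
    forall x, e' x = if x \in N then 0%R else e x.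
  exists (proj_nnsfun e (measurableC mN)) => x.
  rewrite /= mindicE in_setC.
  by case: ifPn; rewrite /= ?mulr0 ?mulr1.
have -> : sintegral mu e = sintegral mu e'.
  rewrite -!integralT_nnsfun; apply: ae_eq_integral => //.
  1,2: exact/measurable_EFinP.
  exists N; split=> // x /=; apply: contra_notP => xN _.
  by rewrite e'E memNset.
apply: ereal_sup_ubound; exists e' => //= x; rewrite e'E.
case: ifPn => // /negP xN; apply: (le_trans (eh x)).
apply: contrapT => /hkN Nx; apply: xN; exact: mem_set.
Qed.

Lemma eq_integral_ae (D : set T) (f g : T -> \bar R) :
  {ae mu, forall x, D x -> f x = g x} ->
  \int[mu]_(x in D) f x = \int[mu]_(x in D) g x.
Proof.
move=> fg; apply/eqP; rewrite eq_le; apply/andP; split; apply: le_integral_ae;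
by apply: filterS fg => x fg /fg ->.
Qed.

End lower_integral.

Section density_measure.
Local Open Scope ereal_scope.
Context d (T : measurableType d) (R : realType) (mu : {measure set T -> \bar R}).
Variables (f : T -> R) (mf : measurable_fun setT f) (f0 : forall x, (0 <= f x)%R).

(** The proofs of measurability and of positivity are arguments so that the
    instance of measure below can be inferred from the set function. *)
Definition density_measure of measurable_fun setT f & (forall x, (0 <= f x)%R) :=
  fun A : set T => \int[mu]_(x in A) (f x)%:E.

Local Notation nu := (density_measure mf f0).

Let nu0 : nu set0 = 0. Proof. exact: integral_set0. Qed.

Let nu_ge0 A : 0 <= nu A.
Proof. by apply: integral_ge0 => x _; rewrite lee_fin. Qed.

Let nu_sigma_additive : semi_sigma_additive nu.
Proof.
move=> A mA tA mUA; rewrite /nu ge0_integral_bigcup//; last 2 first.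
- by apply/measurable_EFinP; exact: measurable_funTS.
- by move=> x _; rewrite lee_fin.
by apply: is_cvg_ereal_nneg_natsum_cond => n _ _; exact: nu_ge0.
Qed.

HB.instance Definition _ := isMeasure.Build _ _ _ nu nu0 nu_ge0 nu_sigma_additive.

End density_measure.

(** * The two-weight inequality for laminar maximal functions *)

(** A recursion rather than an iterated operation, because [0] is not neutral
    for the maximum of a real field. *)
Fixpoint running_max (R : realType) (T : Type) (v : nat -> T -> R) n x : R :=
  if n is m.+1 then Num.max (running_max v m x) (v m x) else 0.

(** The constant of the Carleson embedding [carleson_embedding] for the exponent
    [t = q / p]. *)
Definition sawyer_constant (R : realType) (p q : R) : R :=
  q / p * (2 `^ p) `^ (q / p - 1) * (2 * (p / (p - 1))) `^ p.

Section sawyer.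
Context d (T : measurableType d) (R : realType) (mu : {measure set T -> \bar R}).
Variables (p q K H : R).
Hypotheses (p1 : 1 < p) (pq : p <= q) (K0 : 0 <= K).
Variables (u s f h : T -> R).
Hypotheses (mu' : measurable_fun setT u) (ms : measurable_fun setT s).
Hypotheses (mf : measurable_fun setT f) (mh : measurable_fun setT h).
Hypotheses (u0 : forall x, 0 <= u x) (s0 : forall x, 0 <= s x).
Hypotheses (f0 : forall x, 0 <= f x) (h0 : forall x, 0 <= h x).
Hypothesis fsh : forall x (c : R), 0 < c -> f x <= c * s x + c `^ (1 - p) * h x.
Hypothesis hH : (\int[mu]_x (h x)%:E <= H%:E)%E.
Variables (Q : nat -> set T) (w : nat -> R).
Hypotheses (mQ : forall i, measurable (Q i)) (lamQ : laminar Q).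
Hypothesis w0 : forall i, 0 <= w i.

Local Notation sg := (density_measure mu ms s0).
Local Notation ph := (density_measure mu mf f0).
Local Notation et := (density_measure mu mh h0).
Local Notation om := (density_measure mu mu' u0).

Hypothesis sQ : forall i, (sg (Q i) < +oo)%E.
Hypothesis test : forall i, exists M : T -> \bar R,
  (forall j x, Q j `<=` Q i -> Q j x -> (w j * fine (sg (Q j)))%:E <= M x)%E /\
  (\int[mu]_(x in Q i) (M x `^ q * (u x)%:E) <=
     (K * fine (sg (Q i)) `^ (q / p))%:E)%E.

Let p0 : 0 < p. Proof. exact: lt_trans p1. Qed.
Let q0 : 0 < q. Proof. exact: lt_le_trans pq. Qed.

Let phse A : measurable A -> forall c : R, 0 < c ->
  (ph A <= c%:E * sg A + (c `^ (1 - p))%:E * et A)%E.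
Proof.
move=> mA c c0; rewrite /density_measure.
have mE (g : T -> R) : measurable_fun setT g -> measurable_fun A (EFin \o g).
  by move=> mg; apply/measurable_EFinP; exact: measurable_funTS.
rewrite -!ge0_integralZl ?lee_fin ?powR_ge0 ?(ltW c0)//; last 4 first.
- exact: mE.
- by move=> x _; rewrite lee_fin.
- exact: mE.
- by move=> x _; rewrite lee_fin.
have mZ (k : R) (g : T -> R) : measurable_fun setT g ->
    measurable_fun A (fun x => k%:E * (g x)%:E)%E.
  by move=> mg; apply: (mE (fun x => k * g x)); exact: measurable_funM.
rewrite -ge0_integralD//; last 4 first.
- by move=> x _; rewrite -EFinM lee_fin mulr_ge0// ltW.
- exact: mZ.
- by move=> x _; rewrite -EFinM lee_fin mulr_ge0// powR_ge0.
- exact: mZ.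
by apply: le_integral_ae; apply: aeW => x _; rewrite -!EFinM -EFinD lee_fin fsh.
Qed.

Let H0 : 0 <= H.
Proof.
by rewrite -lee_fin; apply: le_trans hH; apply: integral_ge0 => x _; rewrite lee_fin.
Qed.

Let phfin i : ph (Q i) \is a fin_num.
Proof.
rewrite ge0_fin_numE//; apply: (le_lt_trans (phse (mQ i) ltr01)).
rewrite lte_add_pinfty// lte_mul_pinfty// ?lee_fin ?powR_ge0//.
apply: le_lt_trans (ltry H); apply: le_trans hH.
by rewrite -/(et setT) le_measure ?inE.
Qed.

Let sgfin i : sg (Q i) \is a fin_num. Proof. by rewrite ge0_fin_numE. Qed.

(* the splitting is used with a parameter that tends to infinity *)
Let ph_eq0 i : fine (sg (Q i)) = 0 -> fine (ph (Q i)) = 0.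
Proof.
move=> s_eq0; apply/eqP; rewrite eq_le fine_ge0// andbT leNgt; apply/negP => ph0.
set x := fine (ph (Q i)) in ph0.
have p10 : 0 < p - 1 by rewrite subr_gt0.
have xle (c : R) : 0 < c -> x <= c `^ (1 - p) * (H + 1).
  move=> c0; have := phse (mQ i) c0.
  rewrite -(fineK (sgfin i)) s_eq0 mule0 add0e -(fineK (phfin i)) -/x => xle.
  rewrite -lee_fin; apply: (le_trans xle); rewrite EFinM.
  rewrite lee_wpmul2l ?lee_fin ?powR_ge0//; apply: (@le_trans _ _ H%:E).
    by apply: le_trans hH; rewrite -/(et setT) le_measure ?inE.
  by rewrite lee_fin lerDl.
have H1 : 0 < H + 1 by rewrite ltr_wpDl.
have yp : 0 < (2 * (H + 1)) / x by rewrite divr_gt0// mulr_gt0.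
have := xle _ (powR_gt0 (p - 1)^-1 yp).
rewrite -powRrM (_ : (p - 1)^-1 * (1 - p) = -1); last by field; rewrite gt_eqF.
rewrite powR_inv1 ?(ltW yp)// invf_div -mulrA -{1}(mulr1 x) ler_pM2l//.
rewrite invfM -mulrA mulVf ?gt_eqF// mulr1; lra.
Qed.

Let val i := w i * fine (ph (Q i)).
Let val0 i : 0 <= val i. Proof. by rewrite mulr_ge0// fine_ge0. Qed.

Let Mx := running_max (fun i x => val i * \1_(Q i) x).

Let MxS n x : Mx n.+1 x = Num.max (Mx n x) (val n * \1_(Q n) x).
Proof. by []. Qed.

Let Mx0 n x : 0 <= Mx n x.
Proof. by elim: n => [|n IH]; rewrite ?MxS ?le_max ?IH. Qed.

Let mMx n : measurable_fun setT (Mx n).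
Proof.
elim: n => [|n IH].
  exact: (measurable_cst (0 : R)).
rewrite (_ : Mx n.+1 = Mx n \max (fun x => val n * \1_(Q n) x)); last first.
  by apply/funext => x; rewrite MxS.
apply: measurable_maxr => //; apply: measurable_funM => //.
Qed.

Let le_Mx n i x : (i < n)%N -> Q i x -> val i <= Mx n x.
Proof.
elim: n => // n IH; rewrite ltnS leq_eqVlt MxS le_max => /predU1P[->|iin] Qx.
  by rewrite indicE mem_set// mulr1 lexx orbT.
by rewrite IH.
Qed.

Let Mx_attained n x :
  Mx n x = 0 \/ exists i, [/\ (i < n)%N, Q i x & Mx n x = val i].
Proof.
elim: n => [|n IH]; first by left.
rewrite MxS; have [_|lt] := leP (val n * \1_(Q n) x) (Mx n x).
  by case: IH => [|[i [iin Qx e]]]; [left|right; exists i; rewrite ltnS ltnW].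
right; exists n; rewrite ltnSn; move: lt; rewrite indicE.
have [/set_mem Qx|_] := boolP (x \in Q n); first by rewrite mulr1.
by rewrite mulr0 ltNge Mx0.
Qed.

(* the points at which [i] is the first index to realize the maximum over the
   first [n] members *)
Let E n := seqDU (fun i =>
  if (i < n)%N then Q i `&` [set x | Mx n x <= val i] else set0).

Let mE n i : measurable (E n i).
Proof.
apply: seqDU_measurable => j; case: ifP => // _; apply: measurableI => //.
rewrite [X in measurable X](_ : _ = Mx n @^-1` `]-oo, val j]); last first.
  by apply/seteqP; split => x /=; rewrite in_itv.
by rewrite -[X in measurable X]setTI; exact: mMx.
Qed.

Let EQ n i x : E n i x -> [/\ (i < n)%N, Q i x & Mx n x <= val i].
Proof. by move=> [+ _]; case: ifP => // iin [Qx Mv]. Qed.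

Let trivE n i j x : E n i x -> E n j x -> i = j.
Proof.
move=> Ei Ej; apply: (@trivIset_seqDU _ (fun i => if (i < n)%N then
  Q i `&` [set x | Mx n x <= val i] else set0)) => //; by exists x.
Qed.

Let Mx_E n x :
  Mx n x = 0 \/ exists i, [/\ (i < n)%N, E n i x & Mx n x = val i].
Proof.
have [|[i [iin Qx Me]]] := Mx_attained n x; first by left.
right.
pose F i := if (i < n)%N then Q i `&` [set x | Mx n x <= val i] else set0.
have : (\bigcup_k F k) x.
  by exists i => //; rewrite /F iin; split => //=; rewrite Me.
rewrite seqDU_bigcup_eq => -[k _ Ek]; have [kn Qk Mk] := EQ Ek.
by exists k; split => //; apply/eqP; rewrite eq_le Mk le_Mx.
Qed.

Let a n i := (w i * fine (sg (Q i))) `^ q * fine (om (E n i)).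

Let a0 n i : 0 <= a n i.
Proof. by rewrite mulr_ge0 ?powR_ge0 ?fine_ge0. Qed.

(* the testing condition bounds every function that lies below the [q]-th power
   of all maximal functions subordinate to [Q i] *)
Let MtestQ i (g : T -> \bar R) :
  (forall M : T -> \bar R, (forall j x, Q j `<=` Q i -> Q j x ->
      (w j * fine (sg (Q j)))%:E <= M x)%E ->
    forall x, Q i x -> (g x <= M x `^ q * (u x)%:E)%E) ->
  (\int[mu]_(x in Q i) g x <= (K * fine (sg (Q i)) `^ (q / p))%:E)%E.
Proof.
have [M [Mlb Mint]] := test i.
by move=> /(_ M Mlb) gM; apply: le_trans Mint; apply: le_integral_ae; exact: aeW.
Qed.

Let wpow (j : nat) (y : \bar R) : ((w j * fine (sg (Q j)))%:E <= y)%E ->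
  (((w j * fine (sg (Q j))) `^ q)%:E <= y `^ q)%E.
Proof.
move=> wy; rewrite -poweR_EFin; have ws0 : 0 <= w j * fine (sg (Q j)).
  by rewrite mulr_ge0// fine_ge0.
apply: gt0_ler_poweR; rewrite ?(ltW q0)// in_itv/= ?lee_fin leey ?andbT//.
by rewrite (le_trans _ wy)// lee_fin.
Qed.

Let omfin i : 0 < w i * fine (sg (Q i)) -> om (Q i) \is a fin_num.
Proof.
move=> ws0; rewrite ge0_fin_numE//.
have : (((w i * fine (sg (Q i))) `^ q)%:E * om (Q i) < +oo)%E.
  apply: le_lt_trans (ltry (K * fine (sg (Q i)) `^ (q / p))).
  rewrite /density_measure -ge0_integralZl ?lee_fin ?powR_ge0//; last 2 first.
  - by apply/measurable_EFinP; exact: measurable_funTS.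
  - by move=> x _; rewrite lee_fin.
  apply: MtestQ => M Mlb x Qx; apply: lee_wpmul2r; first by rewrite lee_fin.
  by apply/wpow/Mlb.
move=> lt; rewrite ltNge leye_eq; apply/negP => /eqP e; move: lt.
by rewrite e gt0_muley ?lte_fin ?powR_gt0.
Qed.

Let aE n i : ((val i `^ q)%:E * om (E n i) =
  (a n i * (fine (ph (Q i)) / fine (sg (Q i))) `^ (p * (q / p)))%:E)%E.
Proof.
have [sg_eq0|sgN0] := eqVneq (fine (sg (Q i))) 0.
  by rewrite /a /val ph_eq0// sg_eq0 !mulr0 powR0 ?gt_eqF// mul0e !mul0r.
rewrite /a /val; have := w0 i; rewrite le_eqVlt => /predU1P[<-|wi0].
  by rewrite !mul0r powR0 ?gt_eqF// mul0e !mul0r.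
have sg0 : 0 < fine (sg (Q i)) by rewrite lt_neqAle eq_sym sgN0 fine_ge0.
have ofin : om (E n i) \is a fin_num.
  have := omfin (mulr_gt0 wi0 sg0); rewrite !ge0_fin_numE//.
  apply: le_lt_trans; rewrite le_measure ?inE// => x /EQ[] //.
rewrite -{1}(fineK ofin) -EFinM mulrC [p * _]mulrC divfK ?gt_eqF//.
rewrite -[in LHS](divfK sgN0 (fine (ph (Q i)))).
rewrite [_ / _ * _]mulrC mulrA powRM ?divr_ge0 ?mulr_ge0 ?fine_ge0//.
congr EFin; ring.
Qed.

Let carl n i : (i < n)%N ->
  \sum_(0 <= j < n | `[< Q j `<=` Q i >]) a n j <=
  K * fine (sg (Q i)) `^ (q / p).
Proof.
move=> iin.
pose c j := if `[< Q j `<=` Q i >] then (w j * fine (sg (Q j))) `^ q else 0.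
have c0 j : 0 <= c j by rewrite /c; case: ifP => // _; exact: powR_ge0.
have mcE j : measurable_fun setT (fun x => (c j * (\1_(E n j) x * u x))%:E).
  apply/measurable_EFinP; apply: measurable_funM => //; exact: measurable_funM.
have cE0 j x : (0 <= (c j * (\1_(E n j) x * u x))%:E)%E.
  by rewrite lee_fin !mulr_ge0.
rewrite -lee_fin.
apply: (@le_trans _ _
  (\int[mu]_(x in Q i) \sum_(0 <= j < n) (c j * (\1_(E n j) x * u x))%:E)%E).
  rewrite ge0_integral_sum//; last by move=> j; exact: measurable_funTS.
  rewrite -sumEFin big_mkcond/=; apply: lee_sum => j _.
  rewrite /c; case: asboolP => [ji|_]; last first.
    by apply: integral_ge0 => x _; rewrite mul0r.
  under eq_integral do rewrite EFinM.
  rewrite ge0_integralZl ?lee_fin ?powR_ge0//; last 2 first.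
  - by apply/measurable_EFinP; apply: measurable_funTS; exact: measurable_funM.
  - by move=> x _; rewrite lee_fin mulr_ge0.
  have -> : (\int[mu]_(x in Q i) (\1_(E n j) x * u x)%:E = om (E n j))%E.
    rewrite /density_measure integral_mkcond [RHS]integral_mkcond.
    apply: eq_integral => x _; rewrite /patch indicE.
    have [/set_mem Ex|_] := boolP (x \in E n j); last by rewrite mul0r if_same.
    by rewrite mem_set ?mul1r//; apply: ji; have [] := EQ Ex.
  rewrite /a EFinM.
  have [ws0|ws0] := eqVneq (w j * fine (sg (Q j))) 0.
    by rewrite ws0 powR0 ?gt_eqF// !mul0e.
  have ofin : om (E n j) \is a fin_num.
    have : 0 < w j * fine (sg (Q j)).
      by rewrite lt_neqAle eq_sym ws0 mulr_ge0 ?fine_ge0.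
    move=> /omfin; rewrite !ge0_fin_numE//.
    by apply: le_lt_trans; rewrite le_measure ?inE// => x /EQ[].
  by rewrite fineK.
apply: MtestQ => M Mlb x Qx.
have rhs0 : (0 <= M x `^ q * (u x)%:E)%E by rewrite mule_ge0 ?poweR_ge0 ?lee_fin.
have [[k [kn Ek]]|nE] := pselect (exists k, (k < n)%N /\ E n k x); last first.
  rewrite big_nat_cond big1// => k /andP[/andP[_ kn] _].
  by rewrite indicE memNset ?mul0r ?mulr0// => Ek; apply: nE; exists k.
rewrite (big_rem k)/=; last by rewrite mem_index_iota.
rewrite big_seq_cond big1 ?adde0; last first.
  move=> j /andP[+ _]; rewrite mem_rem_uniq ?iota_uniq// inE => /andP[jk _].
  rewrite indicE memNset ?mul0r ?mulr0// => Ej.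
  by move: jk; rewrite (trivE Ek Ej) eqxx.
rewrite indicE mem_set// mul1r /c; case: asboolP => [ki|_]; last by rewrite mul0r.
rewrite EFinM lee_wpmul2r ?lee_fin//; apply/wpow/Mlb => //.
by have [] := EQ Ek.
Qed.

Let g n x := (Mx n x `^ q * u x)%:E.

Let int_g n : (\int[mu]_x g n x <= (K * sawyer_constant p q * H `^ (q / p))%:E)%E.
Proof.
have t1 : 1 <= q / p by rewrite ler_pdivlMr// mul1r.
have etH : (et setT <= H%:E)%E by exact: hH.
have := carleson_embedding p1 t1 K0 phse etH mQ lamQ sQ (@a0 n) (@carl n).
rewrite -lee_fin; apply: le_trans.
have mcE j : measurable_fun setT (fun x => (val j `^ q * (\1_(E n j) x * u x))%:E).
  apply/measurable_EFinP; apply: measurable_funM => //; exact: measurable_funM.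
have cE0 j x : (0 <= (val j `^ q * (\1_(E n j) x * u x))%:E)%E.
  by rewrite lee_fin !mulr_ge0// powR_ge0.
apply: (@le_trans _ _ (\int[mu]_x
    \sum_(0 <= j < n) (val j `^ q * (\1_(E n j) x * u x))%:E)%E); last first.
  rewrite ge0_integral_sum// -sumEFin; apply: lee_sum => j _.
  under eq_integral do rewrite EFinM.
  rewrite ge0_integralZl ?lee_fin ?powR_ge0//; last 2 first.
  - by apply/measurable_EFinP; apply: measurable_funTS; exact: measurable_funM.
  - by move=> x _; rewrite lee_fin mulr_ge0.
  rewrite -aE; rewrite le_eqVlt; apply/orP; left; apply/eqP; congr (_ * _)%E.
  rewrite /density_measure [RHS]integral_mkcond.
  apply: eq_integral => x _; rewrite /patch indicE.
  by case: ifPn; rewrite ?mul1r ?mul0r.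
apply: le_integral_ae; apply: aeW => x _; rewrite /g.
have [->|[k [kn Ek ->]]] := Mx_E n x.
  by rewrite powR0 ?gt_eqF// mul0r; apply: sume_ge0.
rewrite (big_rem k)/=; last by rewrite mem_index_iota.
rewrite indicE mem_set// mul1r leeDl//; exact: sume_ge0.
Qed.

(** Sawyer's two-weight theorem for the maximal function of a countable laminar
    family, the function being [f] and [s] the dual weight. A finite part of the
    family is treated first. Its maximal function [Mx n] takes the value [val i]
    on the set [E n i], so that the [q]-th power of its norm is the sum of
    [val i `^ q * om (E n i)]; with [val i = w i * sg (Q i) * average], this is
    a sum of [q]-th powers of averages with the masses [a n i]. Since the sets
    [E n i] are disjoint, the testing condition yields the Carleson condition
    for these masses. The increasing limit of the maximal
    functions gives [G]. *)
Theorem laminar_two_weight : exists G : T -> \bar R,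
  [/\ measurable_fun setT G, forall x, (0 <= G x)%E,
      (\int[mu]_x G x <= (K * sawyer_constant p q * H `^ (q / p))%:E)%E &
      forall i x, Q i x -> (((w i)%:E * ph (Q i)) `^ q * (u x)%:E <= G x)%E].
Proof.
have g0 n x : (0 <= g n x)%E by rewrite lee_fin mulr_ge0// powR_ge0.
have nd_g x : {homo g^~ x : n m / (n <= m)%N >-> (n <= m)%E}.
  apply: homo_leq => [//|y z t|n]; first exact: le_trans.
  rewrite lee_fin ler_wpM2r// ge0_ler_powR ?nnegrE ?(ltW q0)//.
  by rewrite MxS le_max lexx.
have mg n : measurable_fun setT (g n).
  apply/measurable_EFinP; apply: measurable_funM => //.
  apply: (measurableT_comp (measurable_powR q)) => //.
have cvg_g x : cvgn (g^~ x) by apply: ereal_nondecreasing_is_cvgn; exact: nd_g.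
exists (fun x => limn (g^~ x)); split.
- by apply: (@emeasurable_fun_cvg _ _ _ setT g) => [|x _]; [exact: mg|exact: cvg_g].
- by move=> x; apply: lime_ge => //; exact: nearW.
- rewrite monotone_convergence//; apply: lime_le; last exact: nearW.
  apply: ereal_nondecreasing_is_cvgn => n m nm.
  by apply: le_integral_ae; apply: aeW => x _; exact: nd_g.
- move=> i x Qx.
  have -> : ((w i)%:E * ph (Q i) = (val i)%:E)%E by rewrite EFinM fineK.
  rewrite poweR_EFin -EFinM.
  apply: (@le_trans _ _ (g i.+1 x)).
    rewrite lee_fin ler_wpM2r// (ge0_ler_powR (ltW q0)) ?nnegrE//.
    exact: le_Mx.
  apply: lime_ge => //; near=> n; apply: nd_g; near: n; exact: nbhs_infty_ge.
Unshelve. all: by end_near. Qed.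

End sawyer.

(** * Two dyadic grids of the line *)

Section grids.
Context {R : realType}.
Variables (L : R) (L0 : 0 < L).

(** The side shrinks with the generation [k] while the offset does not depend on
    it: the translate of a dyadic grid is again nested. *)
Definition grid_side (k : nat) : R := L / 2 ^+ k.

Definition grid_offset (b : bool) : R := if b then L / 3 else 0.

Definition grid_index (b : bool) (k : nat) (z : R) : int :=
  Num.floor ((z - grid_offset b) / grid_side k).

Lemma grid_side_gt0 k : 0 < grid_side k.
Proof. by rewrite divr_gt0// exprn_gt0. Qed.

Lemma floor_double_inj (z z' : R) :
  Num.floor (2 * z) = Num.floor (2 * z') -> Num.floor z = Num.floor z'.
Proof.
move=> e; have half (y : R) :
    2 * Num.floor y <= Num.floor (2 * y) < 2 * Num.floor y + 2.
  have /andP[y1 y2] := floor_itv y.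
  rewrite floor_ge_int floor_lt_int intrD intrM.
  by move: y1 y2; rewrite intrD; lra.
by have := half z; have := half z'; rewrite e; lia.
Qed.

Lemma grid_index_coarsen b k k' z z' : (k <= k')%N ->
  grid_index b k' z = grid_index b k' z' -> grid_index b k z = grid_index b k z'.
Proof.
move=> /subnKC <-; elim: (k' - k)%N => [|m IH]; first by rewrite addn0.
rewrite addnS => e; apply: IH; apply: floor_double_inj; move: e.
have dbl y : 2 * ((y - grid_offset b) / grid_side (k + m)) =
    (y - grid_offset b) / grid_side (k + m).+1.
  by rewrite /grid_side exprS; field; rewrite expf_neq0// gt_eqF.
by rewrite !dbl.
Qed.

Lemma grid_index_floor b k z : 
  (grid_index b k z)%:~R * grid_side k <= z - grid_offset b <
  (grid_index b k z)%:~R * grid_side k + grid_side k.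
Proof.
have s0 := grid_side_gt0 k.
have := floor_itv ((z - grid_offset b) / grid_side k).
rewrite -/(grid_index b k z) ler_pdivlMr// ltr_pdivrMr// intrD mulrDl mul1r//.
Qed.

(** The endpoints of the two grids stay apart: a point of the first and a point
    of the second differ by [(n + 2 ^ k / 3) * grid_side k] for an integer [n],
    hence by at least a third of the side since [3] does not divide [2 ^ k]. A
    half-open interval of at most that length contains no two such points. *)
Lemma one_third_trick k z z' : `|z - z'| <= grid_side k / 3 ->
  exists b, grid_index b k z = grid_index b k z'.
Proof.
wlog zz' : z z' / z <= z'.
  move=> W; case: (leP z z') => [/W//|/ltW/W + le]; rewrite distrC => /(_ le)[b e].
  by exists b; rewrite e.
rewrite distrC ger0_norm ?subr_ge0// => d3.
apply: contrapT => nex; have s0 := grid_side_gt0 k.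
have sep b : exists N : int, z < N%:~R * grid_side k + grid_offset b <= z'.
  exists (grid_index b k z').
  have lt : grid_index b k z < grid_index b k z'.
    rewrite lt_neqAle; apply/andP; split; last first.
      by apply: le_floor; rewrite ler_wpM2r ?invr_ge0 ?(ltW s0)// lerB.
    by apply/eqP => e; apply: nex; exists b.
  have /andP[z1 z2] := grid_index_floor b k z.
  have /andP[z3 z4] := grid_index_floor b k z'.
  have : (grid_index b k z)%:~R + 1 <= (grid_index b k z')%:~R :> R.
    by rewrite -[1]/(1%:~R) -intrD ler_int lezD1.
  by move=> NN; apply/andP; split; [nra|lra].
have [N /andP[N1 N2]] := sep false; have [M /andP[M1 M2]] := sep true.
move: N1 N2 M1 M2; rewrite /grid_offset.
have -> : L / 3 = 2 ^+ k * (grid_side k / 3).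
  by rewrite /grid_side; field; rewrite gt_eqF ?exprn_gt0.
move=> N1 N2 M1 M2.
have : -1 < (3 * (N%:~R - M%:~R) - 2 ^+ k : R) < 1.
  by apply/andP; split; rewrite -(ltr_pM2r s0); nra.
have -> : 3 * (N%:~R - M%:~R) - 2 ^+ k = (3 * (N - M) - (2 ^ k)%N%:Z)%:~R :> R.
  by rewrite intrB intrM intrB -pmulrn natrX.
rewrite -[1]/(1%:~R) -[- 1%:~R]/((-1)%:~R) !ltr_int => /andP[h1 h2].
have e : (3 * (N - M) = (2 ^ k)%N%:Z)%R by lia.
have : (3 %| 2 ^ k)%N by lia.
by rewrite Euclid_dvdX// => /andP[].
Qed.

End grids.

(** * Gaussian measure of cubes and the admissible radius *)

Section gaussian_cubes.
Context {R : realType} {d : nat}.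
Implicit Types (x y c z : Rvec R d).
Local Notation leb := (lebesgue_Rvec R d).
Local Notation gamma := (@gauss R d : {measure set (Rvec R d) -> \bar R}).

Lemma measurable_box (A : 'I_d -> set (measurableTypeR R)) :
  (forall i, measurable (A i)) ->
  measurable [set x : Rvec R d | forall i, A i (tnth x i)].
Proof.
move=> mA; rewrite (_ : mkset _ =
    \bigcap_(i in [set: 'I_d]) ((@tnth _ _)^~ i @^-1` A i)); last first.
  by rewrite predeqE => x; split=> [h i _|h i]; exact: h.
apply: fin_bigcap_measurable => // i _.
by rewrite -[X in measurable X]setTI; exact: measurable_tnth.
Qed.

Let side_itv c (r : R) (i : 'I_d) : set (measurableTypeR R) :=
  [set` `[(tnth c i : R) - r / 2, (tnth c i : R) + r / 2]].

Let cubeE c r : cube c r = [set x : Rvec R d | forall i,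
  side_itv c r i (tnth x i)].
Proof.
apply/seteqP; split=> x /= h i; have := h i.
  by rewrite /side_itv /= in_itv/= ler_distl.
by rewrite /side_itv /= in_itv/= ler_distl.
Qed.

Lemma measurable_cube c r : measurable (cube c r).
Proof.
rewrite cubeE; apply: (@measurable_box (side_itv c r)) => i.
exact: measurable_itv.
Qed.

Lemma lebesgue_cube c r : 0 < r -> leb (cube c r) = (r ^+ d)%:E.
Proof.
move=> r0; rewrite cubeE (@lebesgue_Rvec_box R d (side_itv c r)); last first.
  by move=> i; exact: measurable_itv.
rewrite (eq_bigr (fun=> r%:E)); last first.
  move=> i _; rewrite /side_itv lebesgue_measure_itv/= lte_fin ifT; last by lra.
  by rewrite -EFinD; congr EFin; lra.
by rewrite prodEFin prodr_const card_ord.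
Qed.

Lemma lebesgue_hyperplane (i : 'I_d) (r : R) :
  leb [set x | (tnth x i : R) = r] = 0%E.
Proof.
pose A j : set (measurableTypeR R) := if j == i then [set r] else setT.
rewrite (_ : mkset _ = [set x : Rvec R d | forall j, A j (tnth x j)]).
  rewrite (@lebesgue_Rvec_box R d A); last first.
    by move=> j; rewrite /A; case: ifP => // _; exact: measurable_set1.
  by rewrite (bigD1 i)//= /A eqxx lebesgue_measure_set1 mul0e.
apply/seteqP; split=> x /= h; last by have := h i; rewrite /A eqxx.
by move=> j; rewrite /A; case: eqP => [->|].
Qed.

Lemma measurable_hyperplane (i : 'I_d) (r : R) :
  measurable [set x : Rvec R d | (tnth x i : R) = r].
Proof.
have := @measurable_tnth _ (measurableTypeR R) d i measurableT [set r]
  (measurable_set1 r).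
by rewrite setTI.
Qed.

Lemma gauss_le A M : measurable A -> 0 <= M ->
  (forall x, A x -> gauss_density x <= M) -> (gamma A <= M%:E * leb A)%E.
Proof.
move=> mA M0 AM; rewrite -integral_cst//; apply: le_integral_ae.
by apply: aeW => x /AM; rewrite lee_fin.
Qed.

Lemma gauss_ge A M : measurable A -> 0 <= M ->
  (forall x, A x -> M <= gauss_density x) -> (M%:E * leb A <= gamma A)%E.
Proof.
move=> mA M0 AM; rewrite -integral_cst//; apply: le_integral_ae.
by apply: aeW => x /AM; rewrite lee_fin.
Qed.

Lemma gauss_null A : measurable A -> leb A = 0%E -> gamma A = 0%E.
Proof.
move=> mA A0; apply: null_set_integral => //.
apply/measurable_EFinP/measurable_funTS; exact: measurable_gauss_density.
Qed.

Lemma ae_gauss (P : Rvec R d -> Prop) :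
  {ae leb, forall x, P x} -> {ae gamma, forall x, P x}.
Proof.
by move=> [N [mN N0 PN]]; exists N; split => //; exact: gauss_null.
Qed.

Lemma gauss_density_gt0 x : 0 < gauss_density x.
Proof. by rewrite mulr_gt0 ?expR_gt0// powR_gt0// pi_gt0. Qed.

Lemma gauss_density_le x : gauss_density x <= pi `^ (- (d%:R / 2)).
Proof.
by rewrite ler_piMr ?powR_ge0// -expR0 ler_expR oppr_le0 sqr_ge0.
Qed.

Lemma gauss_cube_le c r : 0 < r ->
  (gamma (cube c r) <= (pi `^ (- (d%:R / 2)) * r ^+ d)%:E)%E.
Proof.
move=> r0; rewrite EFinM -(lebesgue_cube c r0).
apply: gauss_le => [||x _]; first exact: measurable_cube.
- exact: powR_ge0.
- exact: gauss_density_le.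
Qed.

Lemma gauss_cube_fin c r : 0 < r -> gamma (cube c r) \is a fin_num.
Proof.
move=> r0; rewrite ge0_fin_numE//; apply: le_lt_trans (gauss_cube_le c r0) _.
exact: ltry.
Qed.

Lemma gauss_cube_gt0 c r : 0 < r -> (0 < gamma (cube c r))%E.
Proof.
move=> r0; rewrite lt_neqAle measure_ge0 andbT; apply/negP => /eqP e.
have mD : measurable_fun (cube c r) (fun x : Rvec R d => (gauss_density x)%:E).
  by apply/measurable_EFinP/measurable_funTS; exact: measurable_gauss_density.
have : (\int[leb]_(x in cube c r) `|(gauss_density x)%:E| = 0)%E.
  rewrite [RHS]e; apply: eq_integral => x _.
  by rewrite gee0_abs// lee_fin gauss_density_ge0.
move=> /(ae_eq_integral_abs _ (measurable_cube c r) mD)[N [mN N0 cN]].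
have : (leb (cube c r) <= leb N)%E.
  rewrite le_measure ?inE//; first exact: measurable_cube.
  move=> x cx; apply: cN => /= /(_ cx) [] /eqP.
  by rewrite gt_eqF// gauss_density_gt0.
by rewrite N0 lebesgue_cube// lee_fin leNgt exprn_gt0.
Qed.

Lemma enorm_ge0 x : 0 <= enorm x. Proof. exact: sqrtr_ge0. Qed.

Lemma enormE x : enorm x ^+ 2 = \sum_(i < d) (tnth x i : R) ^+ 2.
Proof. by rewrite sqr_sqrtr// sumr_ge0// => i _; exact: sqr_ge0. Qed.

Lemma tnth_le_enorm x i : `|tnth x i : R| <= enorm x.
Proof.
rewrite -sqrtr_sqr ler_sqrt ?sumr_ge0// => [|j _]; last exact: sqr_ge0.
by rewrite (bigD1 i)//= lerDl sumr_ge0// => j _; exact: sqr_ge0.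
Qed.

Lemma admissibleE x : admissible x = (Num.max 1 (enorm x))^-1.
Proof.
rewrite /admissible; have [->|x0] := eqVneq (enorm x) 0.
  by rewrite max_l// invr1.
have {}x0 : 0 < enorm x by rewrite lt_neqAle eq_sym x0 enorm_ge0.
have [x1|x1] := leP (enorm x) 1.
  by rewrite invr1 min_l// invf_ge1.
by rewrite min_r// invf_le1// ltW.
Qed.

Lemma admissible_gt0 x : 0 < admissible x.
Proof. by rewrite admissibleE invr_gt0 lt_max ltr01. Qed.

Lemma admissible_le1 x : admissible x <= 1.
Proof. by rewrite admissibleE invf_le1 ?lt_max ?ltr01// le_max lexx. Qed.

Lemma admissible_enorm x : admissible x * enorm x <= 1.
Proof.
rewrite admissibleE mulrC ler_pdivrMr ?lt_max ?ltr01//.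
by rewrite mul1r le_max lexx orbT.
Qed.

(** The triangle inequality for the Euclidean norm, at a point of a cube and at
    its center. *)
Lemma enorm_near x c (r : R) : 0 <= r -> cube c r x ->
  enorm c <= enorm x + Num.sqrt d%:R * r / 2.
Proof.
move=> r0 cx; have X0 := enorm_ge0 x; set X := enorm x in X0 *.
set Y := Num.sqrt d%:R * r / 2.
have Y0 : 0 <= Y by rewrite /Y !mulr_ge0// sqrtr_ge0.
pose e i := (tnth c i : R) - tnth x i.
have eY : \sum_(i < d) e i ^+ 2 <= Y ^+ 2.
  rewrite /Y !exprMn sqr_sqrtr// -mulrA mulr_natl -[d in leRHS]card_ord.
  rewrite -sumr_const; apply: ler_sum => i _.
  rewrite -exprMn -ler_sqrt ?sqr_ge0// !sqrtr_sqr [leRHS]ger0_norm ?divr_ge0//.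
  by rewrite /e distrC; exact: cx.
clearbody Y.
(* Cauchy-Schwarz, from the arithmetic-geometric mean inequality applied to
   each term after rescaling by the two norms *)
have cross : \sum_(i < d) (tnth x i : R) * e i <= X * Y.
  have := eY; have [X00|X_gt0] := eqVneq X 0.
    move=> _; rewrite X00 mul0r big1// => i _.
    suff -> : (tnth x i : R) = 0 by rewrite mul0r.
    by apply/eqP; rewrite -normr_le0 -X00; exact: tnth_le_enorm.
  have [Y00|Y_gt0] := eqVneq Y 0.
    rewrite Y00 mulr0 expr0n/= => e0; rewrite big1// => i _.
    have : e i ^+ 2 <= 0.
      apply: le_trans e0; rewrite (bigD1 i)//= lerDl sumr_ge0// => j _.
      exact: sqr_ge0.
    by rewrite le_eqVlt ltNge sqr_ge0 orbF sqrf_eq0 => /eqP ->; rewrite mulr0.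
  have X1 : 0 < X by rewrite lt_neqAle eq_sym X_gt0.
  have Y1 : 0 < Y by rewrite lt_neqAle eq_sym Y_gt0.
  move=> eY'.
  apply: (@le_trans _ _ (\sum_(i < d) ((Y / X / 2) * (tnth x i : R) ^+ 2
     + (X / Y / 2) * e i ^+ 2))).
    apply: ler_sum => i _; set a := (tnth x i : R); set b := e i.
    rewrite -subr_ge0.
    have -> : Y / X / 2 * a ^+ 2 + X / Y / 2 * b ^+ 2 - a * b =
       (Y * a - X * b) ^+ 2 / (2 * (X * Y)) by field; rewrite !gt_eqF.
    by rewrite divr_ge0 ?sqr_ge0// !mulr_ge0.
  rewrite big_split/= -!mulr_sumr -enormE -/X.
  apply: (le_trans (lerD (lexx _) (ler_wpM2l _ eY'))).
    by rewrite !divr_ge0.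
  by rewrite le_eqVlt; apply/orP; left; apply/eqP; field; rewrite !gt_eqF.
rewrite -(@ler_pXn2r _ 2)// ?nnegrE ?enorm_ge0// ?addr_ge0//.
rewrite enormE (eq_bigr (fun i => (tnth x i : R) ^+ 2
  + 2 * ((tnth x i : R) * e i) + e i ^+ 2)); last first.
  by move=> i _; rewrite /e; ring.
rewrite !big_split/= -mulr_sumr -enormE -/X.
by move: cross eY; nra.
Qed.

End gaussian_cubes.

(** * Local doubling and the cells of the grids *)

Section local_geometry.
Context {R : realType} {d : nat}.
Implicit Types (x y c z : Rvec R d).
Local Notation leb := (lebesgue_Rvec R d).
Local Notation gamma := (@gauss R d : {measure set (Rvec R d) -> \bar R}).
Variables (a : R) (a0 : 0 < a).

(** Moving from [x] to the center of a cube of side [r <= 3 a m(x)] containing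
    it changes the norm by at most [sqrt d * r / 2]. Since the inverse of [m] is
    [max 1 |.|], the ratio of the side of the cube to [m] at its center is at
    most [3 a + (9 / 2) sqrt d a ^ 2], half of the bound assumed on [b]. *)
Lemma cube_local (b : R) x c (r : R) :
    6 * a + 9 * Num.sqrt d%:R * a ^+ 2 < b ->
    0 < r -> r <= 3 * a * admissible x -> cube c r x ->
  local_cubes b (cube c r).
Proof.
move=> ab r0 rx cx; exists c, r; split => //.
have near := enorm_near (ltW r0) cx.
have mx := admissible_gt0 x; have mx1 := admissible_le1 x.
have mX := admissible_enorm x; have X0 := enorm_ge0 x.
set m := admissible x in rx mx mx1 mX *.
set X := enorm x in near mX X0 *.
rewrite admissibleE ler_pdivlMr ?lt_max ?ltr01//.
have D0 : 0 <= Num.sqrt d%:R :> R by exact: sqrtr_ge0.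
set D := Num.sqrt d%:R in near ab D0 *.
have D0a : 0 <= D * a ^+ 2 by rewrite mulr_ge0// sqr_ge0.
have r3 : r <= 3 * a.
  by apply: (le_trans rx); rewrite ler_piMr// mulr_ge0// ltW.
have rr : r * r <= 9 * a ^+ 2 by nra.
have [c1|c1] := leP (enorm c) 1; first by rewrite mulr1; nra.
apply: (@le_trans _ _ (r * (X + D * r / 2))); first by rewrite ler_wpM2l// ltW.
have rX : r * X <= 3 * a.
  apply: (@le_trans _ _ (3 * a * m * X)); first by rewrite ler_wpM2r.
  by rewrite -mulrA ler_piMr// mulr_ge0// ltW.
by have := ler_wpM2l D0 rr; nra.
Qed.

(** A bound on the ratio of the values of the Gaussian density at two points
    that are closer, in the supremum norm, than a multiple of the admissible
    radius. *)
Definition density_ratio : R := expR (d%:R * (8 * a + 16 * a ^+ 2)).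

(** This is the reason for the admissible scale: a displacement of size
    [4 a m(x)] changes [|x| ^ 2] by a bounded amount, as [m(x) * |x| <= 1]. *)
Lemma gauss_density_near x z :
    (forall i, `|(tnth z i : R) - tnth x i| <= 4 * a * admissible x) ->
  gauss_density z <= density_ratio * gauss_density x /\
  gauss_density x <= density_ratio * gauss_density z.
Proof.
move=> zx; have X0 := enorm_ge0 x.
have mx := admissible_gt0 x; have mx1 := admissible_le1 x.
have mX := admissible_enorm x.
have dif i : `|(tnth z i : R) ^+ 2 - (tnth x i : R) ^+ 2| <= 8 * a + 16 * a ^+ 2.
  have := zx i; have := tnth_le_enorm x i.
  set m := admissible x in mx mx1 mX *; set X := enorm x in mX X0 *.
  set u := (tnth x i : R); set w := (tnth z i : R) => uX wu.
  have -> : w ^+ 2 - u ^+ 2 = (w - u) * (w + u) by ring.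
  rewrite normrM.
  have wpu : `|w + u| <= 4 * a * m + 2 * X.
    have -> : w + u = (w - u) + 2 * u by ring.
    rewrite (le_trans (ler_normD _ _))// lerD//.
    by rewrite normrM ger0_norm// ler_wpM2l.
  apply: (@le_trans _ _ (4 * a * m * (4 * a * m + 2 * X))).
    by apply: ler_pM.
  have -> : 4 * a * m * (4 * a * m + 2 * X) =
    8 * a * (m * X) + 16 * a ^+ 2 * m ^+ 2 by ring.
  have aa : 0 <= a ^+ 2 by exact: sqr_ge0.
  apply: lerD; first by rewrite ler_piMr// mulr_ge0// ltW.
  by apply: ler_piMr; [exact: mulr_ge0|rewrite exprn_ile1// ltW].
have sums : `|enorm z ^+ 2 - enorm x ^+ 2| <= d%:R * (8 * a + 16 * a ^+ 2).
  rewrite !enormE -sumrB (le_trans (ler_norm_sum _ _ _))//.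
  rewrite mulr_natl -[d in leRHS]card_ord -sumr_const.
  by apply: ler_sum => i _; exact: dif.
move: sums; rewrite ler_norml => /andP[h1 h2]; rewrite /gauss_density /density_ratio.
split; rewrite mulrCA ler_wpM2l ?powR_ge0// -expRD ler_expR; lra.
Qed.

Definition doubling_constant : R := 6 ^+ d * density_ratio ^+ 2.

(** On cubes of admissible size the Gaussian measure is comparable to a multiple
    of the Lebesgue measure, so that it inherits the doubling property. *)
Lemma gauss_cube_doubling x c (r s t : R) :
    0 < s -> s <= a * admissible x / 2 -> r <= 6 * s -> s <= t -> 0 < r ->
    cube c r x ->
  (gamma (cube c r) <= doubling_constant%:E * gamma (cube x t))%E.
Proof.
move=> s0 sx rs st r0 cx; have mx := admissible_gt0 x.
have am0 : 0 < a * admissible x by rewrite mulr_gt0.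
have near_c z : cube c r z -> gauss_density z <= density_ratio * gauss_density x.
  move=> cz; apply: (gauss_density_near _).1 => i; rewrite -mulrA.
  have := ler_distD (tnth c i : R) (tnth z i : R) (tnth x i).
  by have := cz i; have := cx i; rewrite [`|_ - (tnth c i : R)|]distrC; lra.
have near_x z : cube x s z -> density_ratio^-1 * gauss_density x <= gauss_density z.
  move=> xz; rewrite mulrC ler_pdivrMr ?expR_gt0// mulrC.
  apply: (gauss_density_near _).2 => i; rewrite -mulrA.
  by have := xz i; lra.
have D0 := gauss_density_ge0 x; have K0 : 0 < density_ratio by exact: expR_gt0.
have t0 : 0 < t by exact: lt_le_trans st.
apply: (@le_trans _ _ ((density_ratio * gauss_density x)%:E * leb (cube c r))%E).
  by apply: gauss_le => //; [exact: measurable_cube|rewrite mulr_ge0// ltW].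
apply: (@le_trans _ _
    (doubling_constant%:E *
      ((density_ratio^-1 * gauss_density x)%:E * leb (cube x s)))%E).
  rewrite !lebesgue_cube// -!EFinM lee_fin /doubling_constant.
  have -> : 6 ^+ d * density_ratio ^+ 2 *
      (density_ratio^-1 * gauss_density x * s ^+ d) =
    density_ratio * gauss_density x * (6 * s) ^+ d.
    by rewrite exprMn; field; rewrite gt_eqF.
  apply: ler_wpM2l; first by rewrite mulr_ge0// ltW.
  by rewrite lerXn2r// nnegrE ltW// mulr_gt0.
rewrite lee_wpmul2l ?lee_fin ?mulr_ge0 ?exprn_ge0 ?(ltW K0)//.
apply: (@le_trans _ _ (gamma (cube x s))).
  by apply: gauss_ge => //; [exact: measurable_cube|rewrite mulr_ge0// invr_ge0 ltW].
rewrite le_measure ?inE//; [exact: measurable_cube|exact: measurable_cube|].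
by move=> z xz i; apply: (le_trans (xz i)); rewrite ler_pM2r.
Qed.

End local_geometry.

Section cells.
Context {R : realType} {d : nat}.
Implicit Types (x y c z : Rvec R d).
Local Notation gamma := (@gauss R d : {measure set (Rvec R d) -> \bar R}).
Variables (L : R) (L0 : 0 < L).

(** The cells are half-open, which makes them laminar; the cubes of the testing
    condition are their closures, which differ from them by a null set. *)
Definition cell (t : {ffun 'I_d -> bool}) (kn : nat * {ffun 'I_d -> int}) :
    set (Rvec R d) :=
  [set x | forall i, grid_index L (t i) kn.1 (tnth x i : R) = kn.2 i].

Definition cell_center (t : {ffun 'I_d -> bool}) (kn : nat * {ffun 'I_d -> int}) :
    Rvec R d :=
  [tuple ((kn.2 i)%:~R + 2^-1) * grid_side L kn.1 + grid_offset L (t i) | i < d].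

Definition cell_cube t kn : set (Rvec R d) :=
  cube (cell_center t kn) (grid_side L kn.1).

Definition cell_of (t : {ffun 'I_d -> bool}) k x : nat * {ffun 'I_d -> int} :=
  (k, [ffun i => grid_index L (t i) k (tnth x i : R)]).

Lemma cell_ofP t k x : cell t (cell_of t k x) x.
Proof. by move=> i /=; rewrite ffunE. Qed.

Lemma cellE t kn : cell t kn = [set x | forall i,
  [set` `[(kn.2 i)%:~R * grid_side L kn.1 + grid_offset L (t i),
          (kn.2 i)%:~R * grid_side L kn.1 + grid_side L kn.1
            + grid_offset L (t i)[ ] (tnth x i : R)].
Proof.
have s0 := grid_side_gt0 L0 kn.1.
apply/seteqP; split=> x cx i; have := cx i; rewrite /= in_itv/=.
  by move=> <-; have := grid_index_floor L0 (t i) kn.1 (tnth x i); lra.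
move=> /andP[h1 h2]; apply/eqP; rewrite /grid_index floor_eq.
by rewrite ler_pdivlMr// ltr_pdivrMr// intrD mulrDl mul1r; apply/andP; split; lra.
Qed.

Lemma measurable_cell t kn : measurable (cell t kn).
Proof.
rewrite cellE; apply: (@measurable_box R d (fun i =>
  [set` `[(kn.2 i)%:~R * grid_side L kn.1 + grid_offset L (t i),
          (kn.2 i)%:~R * grid_side L kn.1 + grid_side L kn.1
            + grid_offset L (t i)[ ])) => i.
exact: measurable_itv.
Qed.

Lemma cell_sub_cube t kn : cell t kn `<=` cell_cube t kn.
Proof.
rewrite cellE => x cx i; have := cx i; rewrite /= in_itv/= tnth_mktuple.
by move=> /andP[h1 h2]; rewrite ler_distl; apply/andP; split; lra.
Qed.

Lemma cell_cube_ae t kn : {ae gamma, forall x, cell_cube t kn x -> cell t kn x}.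
Proof.
pose bd i := (kn.2 i)%:~R * grid_side L kn.1 + grid_side L kn.1
  + grid_offset L (t i).
have : gamma.-negligible (\big[setU/set0]_(i <- enum 'I_d)
    [set x | (tnth x i : R) = bd i]).
  elim: (enum 'I_d) => [|i s IH]; first by rewrite big_nil; exact: negligible_set0.
  rewrite big_cons; apply: negligibleU => //.
  apply/negligibleP; first exact: measurable_hyperplane.
  by apply: gauss_null; [exact: measurable_hyperplane|exact: lebesgue_hyperplane].
apply: negligibleS => x /= /not_implyP[cx ncx].
rewrite -bigcup_seq; apply: contrapT => nb; apply: ncx; rewrite cellE => i.
rewrite /= in_itv/=; have := cx i; rewrite tnth_mktuple ler_distl => /andP[h1 h2].
apply/andP; split; first lra.
rewrite lt_neqAle; apply/andP; split; last lra.
by apply/eqP => e; apply: nb; exists i; rewrite //= mem_enum.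
Qed.

Lemma cell_laminar t : laminar (cell t).
Proof.
move=> [k n] [k' n']; wlog kk' : k k' n n' / (k <= k')%N.
  move=> W; have [/W//|/ltnW/W] := leqP k k'.
  by move=> /(_ n' n)[]; [exact: Or32|exact: Or31|rewrite setIC; exact: Or33].
have [[x [kx kx']]|dis] :=
  pselect (exists x, cell t (k, n) x /\ cell t (k', n') x).
  apply: Or32 => y ky' i; rewrite -kx/=.
  by apply: (grid_index_coarsen L0 kk'); rewrite ky' kx'.
by apply: Or33; rewrite -subset0 => x [kx kx']; apply: dis; exists x.
Qed.

(** The one-third trick is applied to each coordinate separately, hence the need
    for one grid for each choice [t] of offsets. *)
Lemma common_cell k x y :
  (forall i, `|(tnth x i : R) - tnth y i| <= grid_side L k / 3) ->
  exists t, cell t (cell_of t k x) y.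
Proof.
move=> xy; have /choice[t tP] i := one_third_trick L0 (xy i).
exists [ffun i => t i] => i; rewrite /= !ffunE; exact/esym/tP.
Qed.

End cells.

(** * Domination of the fractional integral by averages over cells *)

(** Each of the countably many sets [f > r], with [r] rational, is Borel up to a
    null set; [f] is set to zero on a Borel null set that contains all these
    exceptional sets. *)
Lemma borel_modification d (T : measurableType d) (R : realType)
    (mu : {measure set T -> \bar R}) (f : T -> R) :
    (forall B : set (measurableTypeR R), measurable B ->
      completed_algebra_gen mu (f @^-1` B)) ->
  exists g : T -> R, measurable_fun setT g /\ {ae mu, forall x, f x = g x}.
Proof.
move=> mf; pose r (n : nat) : R := ratr (odflt 0 (unpickle n)).
have /choice[AN ANP] n : exists AN : set T * set T,
    [/\ measurable AN.1, mu.-negligible AN.2 &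
        AN.1 `|` AN.2 = f @^-1` `]r n, +oo[].
  have [A mA [N nN e]] := mf _ (measurable_itv `]r n, +oo[).
  by exists (A, N).
have : mu.-negligible (\bigcup_n (AN n).2).
  by apply: negligible_bigcup => n; have [] := ANP n.
move=> [Z [mZ Z0 NZ]]; pose g x := if x \in Z then 0 else f x.
exists g; split; last first.
  by exists Z; split=> // x /=; apply: contra_notP => xZ; rewrite /g memNset.
move=> _; apply: (measurability _ (RGenOInfty.measurableE R)) => //.
move=> /= _ [_ [x ->] <-]; rewrite setTI.
rewrite (_ : _ @^-1` _ =
   \bigcup_n ((if x < r n then (AN n).1 else set0) `&` ~` Z)
   `|` (if x < 0 then Z else set0)).
  apply: measurableU; last by case: ifP.
  apply: bigcupT_measurable => n; apply: measurableI; last exact: measurableC.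
  by case: ifP => // _; have [] := ANP n.
apply/seteqP; split=> y; rewrite /= in_itv/= andbT /g.
  case: ifPn => [/set_mem yZ x0|/negP yZ xf]; first by right; rewrite x0.
  left; have [s] := rat_in_itvoo xf; rewrite in_itv/= => /andP[xs sf].
  have rs : r (pickle s) = ratr s by rewrite /r pickleK.
  exists (pickle s) => //; rewrite rs xs; split; last by move=> Zy; apply/yZ/mem_set.
  have [_ _ e] := ANP (pickle s).
  have : ((AN (pickle s)).1 `|` (AN (pickle s)).2) y by rewrite e/= in_itv/= rs sf.
  by move=> [//|Ny]; exfalso; apply/yZ/mem_set/NZ; exists (pickle s).
move=> [[n _]|]; last by case: ifP => // x0 Zy; rewrite mem_set.
case: ifP => [xr|_ []//] [Ay nZy]; rewrite memNset//.
have [_ _ e] := ANP n; have : ((AN n).1 `|` (AN n).2) y by left.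
by rewrite e/= in_itv/= andbT; exact: lt_trans.
Qed.

Lemma geometric_nneseries_le (R : realType) (z : R) : 0 <= z < 1 ->
  (\sum_(0 <= k <oo) (z ^+ k)%:E <= ((1 - z)^-1)%:E)%E.
Proof.
move=> /andP[z0 z1]; apply: lime_le.
  by apply: is_cvg_nneseries => k _ _; rewrite lee_fin exprn_ge0.
apply: nearW => n; rewrite sumEFin lee_fin -div1r ler_pdivlMr ?subr_gt0//.
rewrite big_mkord mulrC -opprB mulNr -subrX1 opprB.
by rewrite gerBl exprn_ge0.
Qed.

Section kernel.
Context {R : realType} {d : nat}.
Implicit Types (x y c z : Rvec R d).
Local Notation gamma := (@gauss R d : {measure set (Rvec R d) -> \bar R}).
Variables (a alpha beta : R).
Hypotheses (a0 : 0 < a) (ab : beta < alpha) (ad : alpha < d%:R).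

(** The factor in front of the integral over [Q] in the maximal function of
    order [beta]. *)
Definition gauss_power (Q : set (Rvec R d)) : R :=
  fine (gamma Q) `^ (beta / d%:R - 1).

(* [L / 3 = a / 2] bounds the distance in the supremum norm between the center
   of a cube of side [a * admissible x] and its points *)
Let L : R := 3 * a / 2.
Let L0 : 0 < L. Proof. by rewrite divr_gt0// mulr_gt0. Qed.

Let e : R := 1 - alpha / d%:R.

Definition level_constant : R :=
  (@doubling_constant R d a) `^ e *
  (pi `^ (- (d%:R / 2))) `^ ((alpha - beta) / d%:R).

(** The kernel of the fractional integral carries the power [alpha / d - 1] of
    the Gaussian measure [g] of a cube around [x]. The larger cube of side [r] costs
    a doubling constant; giving up the power [(alpha - beta) / d] of its measure
    leaves the factor of the maximal function of order [beta], and a gain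
    [r `^ (alpha - beta)] that is summable over the generations of the grid. *)
Lemma gauss_power_split c (r g : R) : (0 < d)%N -> 0 < r -> 0 < g ->
  (gamma (cube c r) <= ((@doubling_constant R d a) * g)%:E)%E ->
  g `^ (- e) <= level_constant * r `^ (alpha - beta) * gauss_power (cube c r).
Proof.
move=> d0 r0 g0.
have dR : 0 < d%:R :> R by rewrite ltr0n.
have Gfin := gauss_cube_fin c r0; have Ggt := gauss_cube_gt0 c r0.
have Gle := gauss_cube_le c r0.
rewrite /gauss_power; rewrite -(fineK Gfin) in Ggt Gle *.
set G := fine _ in Ggt Gle *; rewrite !lee_fin in Gle *; rewrite lte_fin in Ggt.
move=> GDg; have D0 : 0 < @doubling_constant R d a.
  by rewrite /doubling_constant mulr_gt0 ?exprn_gt0 ?expR_gt0.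
have e0 : 0 <= e by rewrite subr_ge0 ler_pdivrMr// mul1r ltW.
apply: (@le_trans _ _ ((@doubling_constant R d a) `^ e * G `^ (- e))).
  rewrite !powRN ler_pdivlMr ?powR_gt0// mulrC ler_pdivrMr ?powR_gt0//.
  rewrite -powRM ?(ltW D0) ?(ltW g0)//.
  by apply: ge0_ler_powR => //; rewrite nnegrE; [exact: ltW|rewrite mulr_ge0// ltW].
rewrite (_ : - e = (alpha - beta) / d%:R + (beta / d%:R - 1)); last first.
  by rewrite /e; field; rewrite gt_eqF.
rewrite [G `^ _]powRD; last by rewrite (gt_eqF Ggt) implybT.
rewrite mulrA ler_wpM2r ?powR_ge0// /level_constant -mulrA ler_wpM2l ?powR_ge0//.
have -> : r `^ (alpha - beta) = (r ^+ d) `^ ((alpha - beta) / d%:R).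
  by rewrite -powR_mulrn ?(ltW r0)// -powRrM; congr powR; field; rewrite gt_eqF.
rewrite -powRM ?powR_ge0 ?exprn_ge0 ?(ltW r0)// ge0_ler_powR//.
- by rewrite divr_ge0// ?subr_ge0 ltW.
- by rewrite nnegrE ltW.
- by rewrite nnegrE mulr_ge0 ?powR_ge0// exprn_ge0// ltW.
Qed.

(** The generation [k] is the finest one at which all coordinates of [x] and [y]
    are within a third of the side; the distance [s] along the coordinate that
    fails at generation [k + 1] is comparable to that side. *)
Lemma common_level x y : y <> x -> cube x (a * admissible x) y ->
  exists k (s : R), [/\ 0 < s, s <= a * admissible x / 2, s <= Defs.edist x y,
    grid_side L k <= 6 * s &
    forall i, `|(tnth x i : R) - tnth y i| <= grid_side L k / 3].
Proof.
move=> yx xy; have m1 := admissible_le1 x; have m0 := admissible_gt0 x.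
pose P k := [forall i, `|(tnth x i : R) - tnth y i| <= grid_side L k / 3].
have P0 : P 0%N.
  apply/forallP => i; rewrite /grid_side expr0 divr1 /L distrC.
  apply: (le_trans (xy i)); rewrite (_ : 3 * a / 2 / 3 = a * 1 / 2); last by field.
  by rewrite ler_pM2r// ler_pM2l.
have [i xyi] : exists i, (tnth x i : R) <> tnth y i.
  apply: contrapT => ne; apply: yx; apply: eq_from_tnth => i.
  by apply: contrapT => ni; apply: ne; exists i; exact/nesym.
have d0 : 0 < `|(tnth x i : R) - tnth y i| by rewrite normr_gt0 subr_eq0; exact/eqP.
have exn : exists k, ~~ P k.
  have [k kP] : exists k : nat, L / 3 / `|(tnth x i : R) - tnth y i| < 2 ^+ k.
    exists (Num.bound (L / 3 / `|(tnth x i : R) - tnth y i|)).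
    apply: lt_le_trans (archi_boundP _) _.
      by apply: divr_ge0 => //; apply: divr_ge0 => //; exact: ltW.
    by rewrite -natrX ler_nat ltnW// ltn_expl.
  exists k; apply/forallPn; exists i; rewrite -ltNge /grid_side.
  rewrite ltr_pdivrMr// in kP; rewrite [L / _ / 3]mulrAC.
  by rewrite ltr_pdivrMr ?exprn_gt0// [ltRHS]mulrC.
have := ex_minnP exn; case: ex_minnP => -[|k] nPk minP; first by rewrite P0 in nPk.
have /forallP Pk : P k.
  by apply: contrapT => /negP /minP; rewrite ltnn.
move=> _; have /forallPn[j] := nPk; rewrite -ltNge => sj.
exists k, `|(tnth x j : R) - tnth y j|; split => //.
- by apply: le_lt_trans sj; rewrite divr_ge0// ltW// grid_side_gt0.
- by rewrite distrC; exact: xy.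
- rewrite /Defs.edist -sqrtr_sqr ler_sqrt ?sumr_ge0// => [|l _]; last exact: sqr_ge0.
  by rewrite (bigD1 j)//= lerDl sumr_ge0// => l _; exact: sqr_ge0.
- have -> : grid_side L k = 6 * (grid_side L k.+1 / 3).
    by rewrite /grid_side exprS; field; rewrite expf_neq0.
  by rewrite ler_pM2l// ltW.
Qed.

Let delta := alpha - beta.
Let ratio : R := 2^-1 `^ delta.

Definition kernel_constant : R :=
  #|{ffun 'I_d -> bool}|%:R * (level_constant * L `^ delta) / (1 - ratio).

Let ratio0 : 0 <= ratio. Proof. exact: powR_ge0. Qed.

Let ratio1 : ratio < 1.
Proof.
have -> : 1 = 1 `^ delta :> R by rewrite powR1.
by rewrite /ratio gt0_ltr_powR ?nnegrE ?subr_gt0// invf_lt1// ltr1n.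
Qed.

Lemma kernel_constant_ge0 : 0 <= kernel_constant.
Proof.
rewrite /kernel_constant divr_ge0 ?subr_ge0 ?(ltW ratio1)//.
by rewrite !mulr_ge0 ?powR_ge0.
Qed.

Let le_abs_integral (D : set (Rvec R d)) (f : Rvec R d -> \bar R) :
  (`|\int[gamma]_(x in D) f x| <= \int[gamma]_(x in D) `|f x|)%E.
Proof.
have [X0|X0] := leP 0%E (\int[gamma]_(x in D) f x)%E.
  by rewrite gee0_abs//; apply: le_integral_ae; apply: aeW => x _; exact: lee_abs.
rewrite lte0_abs// leeNl -integral_ge0N//; apply: le_integral_ae; apply: aeW => x _.
by rewrite leeNl -abseN lee_abs.
Qed.

Let grid_side_power k : grid_side L k `^ delta = L `^ delta * ratio ^+ k.
Proof.
rewrite /grid_side powRM ?(ltW L0)//; congr (_ * _).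
by rewrite -exprVn -powR_mulrn// powRAC powR_mulrn.
Qed.

Let singleton_null x : (0 < d)%N -> gamma [set x] = 0%E /\ measurable [set x].
Proof.
move=> d0; pose i := Ordinal d0.
have mx : measurable [set x].
  rewrite (_ : [set x] = [set y : Rvec R d | forall j,
    [set (tnth x j : R)] (tnth y j)]).
    apply: (@measurable_box R d (fun j => [set (tnth x j : R)])) => j.
    exact: measurable_set1.
  apply/seteqP; split => y /=; first by move=> ->.
  move=> h.
  by apply: eq_from_tnth => j; exact: h.
split => //; apply: gauss_null => //; apply/eqP.
rewrite -measure_le0 -(lebesgue_hyperplane i (tnth x i)) le_measure ?inE//.
  exact: measurable_hyperplane.
by move=> y ->.
Qed.

(** Off the diagonal, each [y] shares with [x] a cell whose size is comparable
    with their distance, so the kernel is at most the sum over all grids and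
    generations of the cell factors, with geometrically decreasing coefficients.
    Integrating against [f] bounds the fractional integral by a uniform bound
    [B] for the averages over the cells of [x]; in particular the integral
    converges absolutely. The function [g] is a Borel version of [f]. *)
Lemma local_fractional_integral_le (f g : Rvec R d -> R) x (B : R) : (0 < d)%N ->
    measurable_fun setT g -> {ae gamma, forall y, f y = g y} -> 0 <= B ->
    (forall t k, grid_side L k <= 3 * a * admissible x ->
      ((gauss_power (cell_cube L t (cell_of L t k x)))%:E *
        \int[gamma]_(y in cell L t (cell_of L t k x)) `|g y|%:E <= B%:E)%E) ->
  (`|local_fractional_integral alpha a f x| <= (kernel_constant * B)%:E)%E.
Proof.
move=> d0 mg fg B0 cellB; have dR : 0 < d%:R :> R by rewrite ltr0n.
pose c k := if grid_side L k <= 3 * a * admissible x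
  then level_constant * grid_side L k `^ delta else 0.
have lc0 : 0 <= level_constant by rewrite mulr_ge0 ?powR_ge0.
have c0 k : 0 <= c k by rewrite /c; case: ifP => // _; rewrite mulr_ge0 ?powR_ge0.
pose P t k := cell L t (cell_of L t k x).
pose w t k := gauss_power (cell_cube L t (cell_of L t k x)).
have w0 t k : 0 <= w t k by exact: powR_ge0.
have mP t k : measurable (P t k) by exact: measurable_cell.
pose h t k y : R := c k * w t k * (\1_(P t k) y * `|g y|).
have h0 t k y : 0 <= h t k y by rewrite !mulr_ge0.
have mig t k : measurable_fun setT (fun y => \1_(P t k) y * `|g y|).
  apply: measurable_funM; first exact: measurable_indic.
  exact: (measurableT_comp (@normr_measurable R setT)).
have mh t k : measurable_fun setT (fun y => (h t k y)%:E).
  by apply/measurable_EFinP; apply: measurable_funM.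
pose G y := (\sum_(0 <= k <oo) \sum_(t : {ffun 'I_d -> bool}) (h t k y)%:E)%E.
have sum0 k y : (0 <= \sum_(t : {ffun 'I_d -> bool}) (h t k y)%:E)%E.
  by apply: sume_ge0 => t _; rewrite lee_fin.
have intG : (\int[gamma]_y G y <= (kernel_constant * B)%:E)%E.
  rewrite integral_nneseries//; last by move=> k; exact: emeasurable_sum.
  pose C := #|{ffun 'I_d -> bool}|%:R * (level_constant * L `^ delta) * B.
  apply: (@le_trans _ _ (\sum_(0 <= k <oo) C%:E * (ratio ^+ k)%:E)%E).
    apply: lee_nneseries => [k _ _|k _]; first exact: integral_ge0.
    rewrite ge0_integral_sum//; last by move=> t y _; rewrite lee_fin.
    apply: (@le_trans _ _ (\sum_(t : {ffun 'I_d -> bool})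
        (level_constant * L `^ delta * B * ratio ^+ k)%:E)%E).
      apply: lee_sum => t _.
      rewrite /h; under eq_integral do rewrite EFinM.
      rewrite ge0_integralZl ?lee_fin ?mulr_ge0//; last first.
        by apply/measurable_EFinP; exact: mig.
      have -> : (\int[gamma]_y (\1_(P t k) y * `|g y|)%:E =
                 \int[gamma]_(y in P t k) `|g y|%:E)%E.
        rewrite [RHS]integral_mkcond; apply: eq_integral => y _.
        by rewrite /patch indicE; case: ifPn; rewrite ?mul1r ?mul0r.
      rewrite EFinM -muleA.
      have [small|big] := boolP (grid_side L k <= 3 * a * admissible x).
        apply: (le_trans (lee_wpmul2l _ (cellB t k small))).
          by rewrite lee_fin.
        rewrite /c small -EFinM lee_fin grid_side_power le_eqVlt.
        by apply/orP; left; apply/eqP; ring.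
      by rewrite /c (negbTE big) mul0e lee_fin !mulr_ge0 ?powR_ge0 ?exprn_ge0.
    rewrite sumEFin sumr_const -EFinM lee_fin /C -[X in X <= _]mulr_natl.
    by rewrite cardT -cardE !mulrA.
  rewrite nneseriesZl; last by move=> k _; rewrite lee_fin exprn_ge0.
  have C0 : 0 <= C by rewrite /C !mulr_ge0 ?powR_ge0.
  apply: (le_trans (lee_wpmul2l _ (geometric_nneseries_le _))).
  - by rewrite lee_fin.
  - by rewrite ratio0.
  - rewrite -EFinM lee_fin /kernel_constant /C le_eqVlt.
    by apply/orP; left; apply/eqP; ring.
have kG : {ae gamma, forall y, cube x (a * admissible x) y ->
    (`|(f y)%:E / gamma (cube x (Defs.edist x y)) `^ e| <= G y)%E}.
  have : {ae gamma, forall y, y <> x}.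
    have [x0 mx] := singleton_null x d0.
    by exists [set x]; split => // y /=; exact: contrapT.
  apply: filterS2 fg => y -> yx xy.
  have [k [s [s0 sx sxy sk near]]] := common_level yx xy.
  have [t Pt] := common_cell L0 near.
  have small : grid_side L k <= 3 * a * admissible x by lra.
  have dist0 : 0 < Defs.edist x y by exact: lt_le_trans sxy.
  have gfin := gauss_cube_fin x dist0.
  have ggt := gauss_cube_gt0 x dist0.
  have dbl := gauss_cube_doubling a0 s0 sx sk sxy (grid_side_gt0 L0 k)
    (@cell_sub_cube R d L L0 t (cell_of L t k x) x (cell_ofP L t k x)).
  rewrite -(fineK gfin) -EFinM in dbl; rewrite -(fineK gfin) lte_fin in ggt.
  rewrite -(fineK gfin).
  have split_power := gauss_power_split d0 (grid_side_gt0 L0 k) ggt dbl.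
  apply: (@le_trans _ _ (h t k y)%:E); last first.
    apply: (@le_trans _ _ (\sum_(t : {ffun 'I_d -> bool}) (h t k y)%:E)%E).
      by rewrite (bigD1 t)//= leeDl//; apply: sume_ge0 => t' _; rewrite lee_fin.
    apply: le_trans (nneseries_lim_ge k.+1 (fun j _ _ => sum0 j y)).
    by rewrite big_nat_recr//= leeDr//; exact: sume_ge0.
  rewrite poweR_EFin inver gt_eqF ?powR_gt0// -powRN -EFinM abse_EFin lee_fin normrM.
  rewrite (ger0_norm (powR_ge0 _ _)) /h indicE mem_set// mul1r mulrC.
  by rewrite ler_wpM2r// /c small.
have intk : (\int[gamma]_(y in cube x (a * admissible x))
    `|(f y)%:E / gamma (cube x (Defs.edist x y)) `^ e| <= (kernel_constant * B)%:E)%E.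
  apply: le_trans intG; rewrite integral_mkcond; apply: le_integral_ae.
  apply: filterS kG => y kG _; rewrite /patch; case: ifPn => [/set_mem/kG//|_].
  by apply: nneseries_ge0.
rewrite /local_fractional_integral ifT; last first.
  by apply: le_lt_trans intk (ltry _).
exact: le_trans (le_abs_integral _ _) intk.
Qed.

End kernel.

(** * Consequences of the testing condition *)

Section testing.
Context {R : realType} {d : nat}.
Implicit Types (x y c z : Rvec R d) (Q : set (Rvec R d)).
Local Notation gamma := (@gauss R d : {measure set (Rvec R d) -> \bar R}).

Lemma weight_borel (w : Rvec R d -> R) : weight w ->
  exists w' : Rvec R d -> R, [/\ measurable_fun setT w', forall x, 0 <= w' x &
    {ae gamma, forall x, w x = w' x}].
Proof.
move=> [[mw _] w0]; have [g [mg wg]] := borel_modification mw.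
exists (fun x => Num.max 0 (g x)); split.
- exact: measurable_maxr.
- by move=> x; rewrite le_max lexx.
- by apply: filterS2 w0 (ae_gauss wg) => x w0x wgx; rewrite -wgx max_r.
Qed.

Variables (p q beta b : R) (u v u' v' : Rvec R d -> R).
Hypotheses (p1 : 1 < p) (pq : p <= q).
Hypotheses (mu' : measurable_fun setT u') (u'0 : forall x, 0 <= u' x).
Hypothesis uu' : {ae gamma, forall x, u x = u' x}.
Hypotheses (mv' : measurable_fun setT v') (v'0 : forall x, 0 <= v' x).
Hypothesis vv' : {ae gamma, forall x, v x = v' x}.

Let p0 : 0 < p. Proof. exact: lt_trans p1. Qed.
Let q0 : 0 < q. Proof. exact: lt_le_trans pq. Qed.

(** Since [0 `^ r = 0] for the nonzero exponent [r = 1 - p'], this is the dual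
    weight replaced by zero where the weight vanishes. *)
Definition finite_dual (x : Rvec R d) : R := v' x `^ (1 - p / (p - 1)).

Lemma finite_dual_ge0 x : 0 <= finite_dual x. Proof. exact: powR_ge0. Qed.

Lemma measurable_finite_dual : measurable_fun setT finite_dual.
Proof. exact: (measurableT_comp (measurable_powR _)). Qed.

Lemma dual_weight_ge0 x : (0 <= dual_weight p v x)%E.
Proof. by rewrite /dual_weight; case: ifP => // _; rewrite lee_fin powR_ge0. Qed.

Lemma finite_dual_le :
  {ae gamma, forall x, ((finite_dual x)%:E <= dual_weight p v x)%E}.
Proof.
apply: filterS vv' => x vx; rewrite /dual_weight vx.
by case: ifP => // _; rewrite leey.
Qed.

Lemma dual_weight_finite Q : measurable Q ->
    (\int[gamma]_(x in Q) dual_weight p v x < +oo)%E ->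
  {ae gamma, forall x, Q x -> 0 < v' x /\ dual_weight p v x = (finite_dual x)%:E}.
Proof.
move=> mQ fin.
pose D x : \bar R :=
  if v' x == 0 then +oo%E else (v' x `^ (1 - p / (p - 1)))%:E.
have D0 x : (0 <= D x)%E by rewrite /D; case: ifP => // _; rewrite lee_fin powR_ge0.
have mD : measurable_fun setT D.
  apply: measurable_fun_ifT => //; first exact: measurable_fun_eqr.
  by apply/measurable_EFinP; exact: measurable_finite_dual.
have iD : gamma.-integrable Q D.
  apply/integrableP; split; first exact: measurable_funTS.
  apply: le_lt_trans fin; apply: le_integral_ae.
  by apply: filterS vv' => x vx Qx; rewrite gee0_abs// /dual_weight vx.
apply: filterS2 vv' (integrable_ae mQ iD) => x vx Dx Qx.
have := Dx Qx; rewrite /D /dual_weight vx; case: eqVneq => // v0 _.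
by split => //; rewrite lt_neqAle eq_sym v0 v'0.
Qed.

Lemma local_cube_measurable Q : local_cubes b Q -> measurable Q.
Proof. by move=> [c [r [_ _ ->]]]; exact: measurable_cube. Qed.

Lemma local_cube_gauss_gt0 Q : local_cubes b Q -> 0 < fine (gamma Q).
Proof.
move=> [c [r [r0 _ ->]]]; apply: fine_gt0; rewrite gauss_cube_gt0//=.
by rewrite ltey_eq gauss_cube_fin.
Qed.

Lemma maximal_ge (f : Rvec R d -> \bar R) Q x : local_cubes b Q -> Q x ->
  ((gauss_power beta Q)%:E * \int[gamma]_(y in Q) `|f y| <=
   local_fractional_maximal beta b f x)%E.
Proof.
move=> lQ Qx; apply: ereal_sup_ubound; exists Q => //=.
have [c [r [r0 _ Qc]]] := lQ; have g0 := local_cube_gauss_gt0 lQ.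
rewrite -(fineK (_ : gamma Q \is a fin_num)); last by rewrite Qc gauss_cube_fin.
rewrite poweR_EFin inver gt_eqF ?powR_gt0// -powRN.
by rewrite /gauss_power opprB.
Qed.

Let Mdual Q x := local_fractional_maximal beta b
  (fun y => dual_weight p v y * (\1_Q y)%:E)%E x.

Let int_dual_indic Q : (\int[gamma]_(y in Q) `|dual_weight p v y * (\1_Q y)%:E| =
  \int[gamma]_(y in Q) dual_weight p v y)%E.
Proof.
apply: eq_integral => y Qy; rewrite indicE Qy mule1 gee0_abs//.
exact: dual_weight_ge0.
Qed.

(** If the dual weight has infinite mass on a cube, then the maximal function in
    the testing condition is infinite at every point of the cube, and the
    condition leaves room for [u] only if it vanishes there. *)
Lemma testing_infinite Q : local_cubes b Q ->
    (testing_quotient p q beta b u v Q < +oo)%E ->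
    (\int[gamma]_(x in Q) dual_weight p v x = +oo)%E ->
  {ae gamma, forall x, Q x -> u' x = 0}.
Proof.
move=> lQ; rewrite /testing_quotient => quo Binf; have mQ := local_cube_measurable lQ.
have Minf x : Q x -> (Mdual Q x = +oo)%E.
  move=> Qx; apply/eqP; rewrite -leye_eq.
  apply: le_trans (maximal_ge _ lQ Qx); rewrite int_dual_indic Binf.
  by rewrite gt0_muley// lte_fin powR_gt0// local_cube_gauss_gt0.
have Aint : (\int[gamma]_(x in Q) (Mdual Q x `^ q * (u x)%:E) =
             \int[gamma]_(x in Q) (+oo * (u' x)%:E))%E.
  apply: eq_integral_ae; apply: filterS uu' => x -> Qx.
  by rewrite Minf// poweRyr// gt_eqF.
move: quo; rewrite Binf eqxx andbT; case: ifPn => // Ay _.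
have iu : gamma.-integrable Q (fun x => +oo * (u' x)%:E)%E.
  apply/integrableP; split.
    apply: emeasurable_funM => //.
    by apply/measurable_EFinP; exact: measurable_funTS.
  rewrite ltNge leye_eq; apply: contra Ay => /eqP <-.
  rewrite -/(Mdual Q) Aint; apply/eqP/eq_integral => x _.
  by rewrite gee0_abs// mule_ge0// lee_fin.
apply: filterS (integrable_ae mQ iu) => x + Qx => /(_ Qx).
have := u'0 x; rewrite le_eqVlt => /predU1P[<-//|u0].
by rewrite gt0_mulye.
Qed.

(** The testing quotient solved for its first factor. If the dual weight has
    mass zero, the quotient is [+oo] times that factor, which must vanish. *)
Lemma testing_finite Q (K : R) : local_cubes b Q -> 0 <= K ->
    (testing_quotient p q beta b u v Q <= K%:E)%E ->
    (\int[gamma]_(x in Q) dual_weight p v x < +oo)%E ->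
  (\int[gamma]_(x in Q) (Mdual Q x `^ q * (u x)%:E) <=
   (K `^ q * fine (\int[gamma]_(x in Q) dual_weight p v x) `^ (q / p))%:E)%E.
Proof.
move=> lQ K0; rewrite /testing_quotient => quo Bfin.
move: quo; rewrite -/(Mdual Q).
set A := (\int[gamma]_(x in Q) (Mdual Q x `^ q * (u x)%:E))%E.
set B := (\int[gamma]_(x in Q) dual_weight p v x)%E in Bfin *.
have A0 : (0 <= A)%E.
  rewrite (_ : A = \int[gamma]_(x in Q) (Mdual Q x `^ q * (u' x)%:E))%E.
    by apply: integral_ge0 => x _; rewrite mule_ge0 ?poweR_ge0 ?lee_fin.
  by apply: eq_integral_ae; apply: filterS uu' => x ->.
have B0 : (0 <= B)%E by apply: integral_ge0 => x _; exact: dual_weight_ge0.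
rewrite (lt_eqF Bfin) andbF.
have Bf : B \is a fin_num by rewrite ge0_fin_numE.
rewrite -(fineK Bf) poweR_EFin inver.
set B' := fine B; have B'0 : 0 <= B' by exact: fine_ge0.
have AA : A = ((A `^ q^-1) `^ q)%E.
  by rewrite -poweRrM mulVf ?gt_eqF// poweRe1.
have X0 : (0 <= A `^ q^-1)%E by exact: poweR_ge0.
set X := (A `^ q^-1)%E in AA X0 *.
case: eqVneq => [Bp0|Bpn0] XK.
  have [X00|Xn0] := eqVneq X 0%E.
    by rewrite AA X00 poweR0r ?gt_eqF// lee_fin mulr_ge0 ?powR_ge0.
  move: XK; rewrite gt0_muley; last by rewrite lt_neqAle eq_sym Xn0.
  by rewrite leNgt ltry.
have Bp : 0 < B' `^ p^-1 by rewrite lt_neqAle eq_sym Bpn0 powR_ge0.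
have XKB : (X <= (K * B' `^ p^-1)%:E)%E.
  by move: XK; rewrite lee_pdivrMr.
rewrite AA.
apply: (@le_trans _ _ ((K * B' `^ p^-1)%:E `^ q)%E).
  apply: gt0_ler_poweR; rewrite ?(ltW q0)// in_itv/= leey andbT//.
  by rewrite lee_fin mulr_ge0// ltW.
rewrite poweR_EFin lee_fin powRM ?powR_ge0// -powRrM.
by rewrite [p^-1 * q]mulrC.
Qed.

End testing.

(** * The majorant attached to one grid *)

Section grid_majorant.
Context {R : realType} {d : nat}.
Implicit Types (x y c z : Rvec R d) (Q : set (Rvec R d)).
Local Notation gamma := (@gauss R d : {measure set (Rvec R d) -> \bar R}).
Local Notation cellindex := (nat * {ffun 'I_d -> int})%type.
Variables (L p q beta b K H : R) (u v u' v' f : Rvec R d -> R).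
Hypotheses (L0 : 0 < L) (p1 : 1 < p) (pq : p <= q) (K0 : 0 <= K).
Hypotheses (mu' : measurable_fun setT u') (u'0 : forall x, 0 <= u' x).
Hypothesis uu' : {ae gamma, forall x, u x = u' x}.
Hypotheses (mv' : measurable_fun setT v') (v'0 : forall x, 0 <= v' x).
Hypothesis vv' : {ae gamma, forall x, v x = v' x}.
Hypothesis quoK : forall Q, local_cubes b Q ->
  (testing_quotient p q beta b u v Q <= K%:E)%E.
Hypothesis mf : measurable_fun setT f.
Hypothesis fH : (\int[gamma]_x (`|f x| `^ p * v' x)%:E <= H%:E)%E.

Let p0 : 0 < p. Proof. exact: lt_trans p1. Qed.

(** On a cube where the dual weight has finite mass the weight [v'] is positive
    almost everywhere, so that the cutoff only affects the other cubes. It makes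
    [cut_fun_split] true at every point. *)
Definition cut_fun x : R := if v' x == 0 then 0 else `|f x|.

Lemma cut_fun_ge0 x : 0 <= cut_fun x.
Proof. by rewrite /cut_fun; case: ifP. Qed.

Let mnf : measurable_fun setT (fun x => `|f x|).
Proof. exact: (measurableT_comp (@normr_measurable R setT)). Qed.

Lemma measurable_cut_fun : measurable_fun setT cut_fun.
Proof.
by apply: measurable_fun_ifT => //; exact: measurable_fun_eqr.
Qed.

Let h x : R := `|f x| `^ p * v' x.
Let h0 x : 0 <= h x. Proof. by rewrite mulr_ge0 ?powR_ge0. Qed.
Let mh : measurable_fun setT h.
Proof.
apply: measurable_funM => //.
exact: (measurableT_comp (measurable_powR p)).
Qed.

(** A pointwise substitute for Hoelder's inequality: either [|f|] is at most
    [c s], where [s] is the dual weight, or it may be multiplied by the power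
    [p - 1] of [|f| / (c s)], and [s `^ (1 - p) = v']. *)
Lemma cut_fun_split x (c : R) : 0 < c ->
  cut_fun x <= c * finite_dual p v' x + c `^ (1 - p) * h x.
Proof.
move=> c0; rewrite /cut_fun.
have rhs0 : 0 <= c * finite_dual p v' x + c `^ (1 - p) * h x.
  by rewrite addr_ge0 ?mulr_ge0 ?powR_ge0// ltW.
case: eqVneq => // vN0; have vx : 0 < v' x by rewrite lt_neqAle eq_sym vN0 v'0.
rewrite /finite_dual /h; set s := v' x `^ _.
have s0 : 0 < s by exact: powR_gt0.
have [le|lt] := leP `|f x| (c * s).
  by apply: (le_trans le); rewrite lerDl !mulr_ge0 ?powR_ge0.
have F0 : 0 < `|f x| by apply: le_lt_trans lt; rewrite mulr_ge0// ltW.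
have cs0 : 0 < c * s by rewrite mulr_gt0.
apply: (@le_trans _ _ (c `^ (1 - p) * (`|f x| `^ p * v' x))); last first.
  by rewrite lerDr mulr_ge0// ltW.
have -> : v' x = s `^ (1 - p).
  rewrite /s -powRrM (_ : _ * _ = 1) ?powRr1 ?ltW//.
  by field; rewrite subr_eq0 gt_eqF.
rewrite mulrCA -powRM ?(ltW c0) ?(ltW s0)//.
rewrite (_ : 1 - p = - (p - 1)); last by ring.
rewrite powRN ler_pdivlMr ?powR_gt0//.
rewrite -(mulr_powRB1 (ltW F0) p0) ler_wpM2l//.
rewrite ge0_ler_powR ?nnegrE ?subr_ge0 ?(ltW p1) ?(ltW cs0)//; exact: ltW.
Qed.

Variable t : {ffun 'I_d -> bool}.

(** The cells that take part in the two-weight inequality; on the other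
    admissible cells the weight [u] vanishes almost everywhere, by
    [testing_infinite]. *)
Definition good_cell (kn : cellindex) : Prop := local_cubes b (cell_cube L t kn) /\
  (\int[gamma]_(x in cell_cube L t kn) dual_weight p v x < +oo)%E.

Let good i : option cellindex :=
  obind (fun kn => if `[< good_cell kn >] then Some kn else None) (unpickle i).

Let goodP i kn : good i = Some kn -> good_cell kn.
Proof.
by rewrite /good; case: (unpickle i) => //= k; case: asboolP => // ? [<-].
Qed.

Let Q i : set (Rvec R d) := if good i is Some kn then cell L t kn else set0.
Let w i : R :=
  if good i is Some kn then gauss_power beta (cell_cube L t kn) else 0.

Let mQ i : measurable (Q i).
Proof. by rewrite /Q; case: (good i) => // kn; exact: measurable_cell. Qed.

Let lamQ : laminar Q.
Proof.
move=> i j; rewrite /Q; case: (good i) => [kn|]; last by apply: Or31; exact: sub0set.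
case: (good j) => [kn'|]; [exact: cell_laminar|by apply: Or32; exact: sub0set].
Qed.

Let w0 i : 0 <= w i.
Proof. by rewrite /w; case: (good i) => // kn; exact: powR_ge0. Qed.

Let sg := density_measure gamma (measurable_finite_dual p mv') (finite_dual_ge0 p v').

Let sg_cell kn : good_cell kn ->
  (sg (cell L t kn) = \int[gamma]_(x in cell_cube L t kn) dual_weight p v x)%E.
Proof.
move=> [lQ fin]; have mC := local_cube_measurable lQ.
rewrite /sg /density_measure integral_mkcond [RHS]integral_mkcond.
apply: eq_integral_ae.
have := dual_weight_finite mv' v'0 vv' mC fin.
have := cell_cube_ae L0 t kn.
apply: filterS2 => x cc dual _.
rewrite /patch; have [/set_mem xc|xc] := boolP (x \in cell L t kn).
  have xcc := cell_sub_cube L0 xc.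
  by rewrite mem_set//; have [_ ->] := dual xcc.
by rewrite memNset// => /cc xc'; move: xc; rewrite mem_set.
Qed.

Let sQ i : (sg (Q i) < +oo)%E.
Proof.
rewrite /Q; case e : (good i) => [kn|]; last first.
  by rewrite /sg /density_measure integral_set0.
by have gk := goodP e; rewrite sg_cell//; case: gk.
Qed.

Let test i : exists M : Rvec R d -> \bar R,
  (forall j x, Q j `<=` Q i -> Q j x -> (w j * fine (sg (Q j)))%:E <= M x)%E /\
  (\int[gamma]_(x in Q i) (M x `^ q * (u' x)%:E) <=
     (K `^ q * fine (sg (Q i)) `^ (q / p))%:E)%E.
Proof.
case e : (good i) => [kn|]; last first.
  have Q0 : Q i = set0 by rewrite /Q e.
  exists (cst 0); rewrite Q0; split; first by move=> j x /[apply].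
  by rewrite integral_set0 lee_fin mulr_ge0 ?powR_ge0.
have gk := goodP e; have [lC fC] := gk; set C := cell_cube L t kn in lC fC.
have Qi : Q i = cell L t kn by rewrite /Q e.
exists (local_fractional_maximal beta b
  (fun y => dual_weight p v y * (\1_C y)%:E)%E).
split=> [j x|]; last first.
  rewrite Qi sg_cell// -/C.
  apply: le_trans (testing_finite p1 pq u'0 uu' lC K0 (quoK lC) fC).
  rewrite integral_mkcond [leRHS]integral_mkcond; apply: le_integral_ae.
  apply: filterS uu' => x uux _; rewrite /patch uux.
  have [/set_mem xc|xc] := boolP (x \in cell L t kn).
    by rewrite mem_set//; exact: cell_sub_cube xc.
  by case: ifP => // _; rewrite mule_ge0 ?poweR_ge0 ?lee_fin.
rewrite Qi => Qji Qjx; move: (Qjx) (Qji); rewrite /Q /w.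
case e' : (good j) => [kn'|//] xc sub.
have gk' := goodP e'; have [lC' fC'] := gk'.
have Qj : Q j = cell L t kn' by rewrite /Q e'.
apply: le_trans (maximal_ge beta _ lC' (cell_sub_cube L0 xc)).
rewrite EFinM lee_wpmul2l ?lee_fin ?powR_ge0//.
rewrite fineK; last by rewrite ge0_fin_numE// -Qj sQ.
rewrite /sg /density_measure integral_mkcond [leRHS]integral_mkcond.
apply: le_integral_ae; apply: filterS (finite_dual_le p vv') => y dual _.
rewrite /patch; have [/set_mem yc|yc] := boolP (y \in cell L t kn'); last first.
  by case: ifP => // _; exact: abse_ge0.
rewrite mem_set; last exact: cell_sub_cube yc.
rewrite indicE mem_set; last exact/(cell_sub_cube L0)/sub.
by rewrite mule1 gee0_abs// dual_weight_ge0.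
Qed.

(** For one grid, the laminar two-weight inequality is applied to the family of
    good cells. The maximal function of the testing condition, taken over all
    admissible cubes, dominates the one restricted to the cells. *)
Lemma grid_majorant : exists G : Rvec R d -> \bar R,
  [/\ measurable_fun setT G, forall x, (0 <= G x)%E,
      (\int[gamma]_x G x <= (K `^ q * sawyer_constant p q * H `^ (q / p))%:E)%E &
      forall kn x, good_cell kn -> cell L t kn x ->
        (((gauss_power beta (cell_cube L t kn))%:E *
           \int[gamma]_(y in cell L t kn) `|f y|%:E) `^ q * (u' x)%:E <= G x)%E].
Proof.
have [G [mG G0 intG lbG]] := laminar_two_weight
  (ms := measurable_finite_dual p mv') (s0 := finite_dual_ge0 p v')
  p1 pq (powR_ge0 K q) mu'
  measurable_cut_fun mh u'0 cut_fun_ge0 h0 cut_fun_split fH mQ lamQ w0 sQ test.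
exists G; split => // kn x gk xc.
have e : good (pickle kn) = Some kn by rewrite /good pickleK/= asboolT.
have := lbG (pickle kn) x; rewrite /Q /w e => /(_ xc).
rewrite /density_measure (_ : (\int[gamma]_(y in _) (cut_fun y)%:E)%E =
  (\int[gamma]_(y in cell L t kn) `|f y|%:E)%E)//.
have [lC fC] := gk; apply: eq_integral_ae.
have mC := local_cube_measurable lC.
apply: filterS (dual_weight_finite mv' v'0 vv' mC fC) => y dual yc.
have [vy _] := dual (cell_sub_cube L0 yc).
by rewrite /cut_fun gt_eqF.
Qed.

End grid_majorant.

(** * The strong type inequality *)

Section strong_type.
Context {R : realType} {d : nat}.
Implicit Types (x y c z : Rvec R d) (Q : set (Rvec R d)).
Local Notation gamma := (@gauss R d : {measure set (Rvec R d) -> \bar R}).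
Variables (a p q alpha beta b K : R) (u v u' v' : Rvec R d -> R).
Hypotheses (a0 : 0 < a) (p1 : 1 < p) (pq : p <= q) (alpha0 : 0 < alpha).
Hypotheses (ad : alpha < d%:R) (ab : 6 * a + 9 * Num.sqrt d%:R * a ^+ 2 < b).
Hypotheses (ba : beta < alpha) (K0 : 0 <= K).
Hypotheses (mu' : measurable_fun setT u') (u'0 : forall x, 0 <= u' x).
Hypothesis uu' : {ae gamma, forall x, u x = u' x}.
Hypotheses (mv' : measurable_fun setT v') (v'0 : forall x, 0 <= v' x).
Hypothesis vv' : {ae gamma, forall x, v x = v' x}.
Hypothesis quoK : forall Q, local_cubes b Q ->
  (testing_quotient p q beta b u v Q <= K%:E)%E.

Let p0 : 0 < p. Proof. exact: lt_trans p1. Qed.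
Let q0 : 0 < q. Proof. exact: lt_le_trans pq. Qed.
Let d0 : (0 < d)%N. Proof. by rewrite -(ltr0n R); exact: lt_trans ad. Qed.

Let L : R := 3 * a / 2.
Let L0 : 0 < L. Proof. by rewrite divr_gt0// mulr_gt0. Qed.

(* strictly positive, so that its product with [+oo] is [+oo] *)
Let kappa : R := @kernel_constant R d a alpha beta + 1.
Let kappa0 : 0 < kappa.
Proof. by rewrite ltr_wpDl// kernel_constant_ge0. Qed.

Definition strong_type_constant : R :=
  kappa `^ q * (#|{ffun 'I_d -> bool}|%:R * (K `^ q * sawyer_constant p q)).

Let infinite_cells : {ae gamma, forall x (t : {ffun 'I_d -> bool}) kn,
  local_cubes b (cell_cube L t kn) -> ~ good_cell L p b v t kn ->
  cell L t kn x -> u' x = 0}.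
Proof.
have : {ae gamma, forall x (n : nat), forall t kn,
    unpickle n = Some (t, kn) -> local_cubes b (cell_cube L t kn) ->
    ~ good_cell L p b v t kn -> cell L t kn x -> u' x = 0}.
  apply: ae_foralln => n.
  case e : (unpickle n) => [[t kn]|]; last by apply: aeW => x t kn.
  have [lC|nlC] := pselect (local_cubes b (cell_cube L t kn)); last first.
    by apply: aeW => x t' kn' [<- <-].
  have [gC|ngC] := pselect (good_cell L p b v t kn).
    by apply: aeW => x t' kn' [<- <-].
  have inf : (\int[gamma]_(x in cell_cube L t kn) dual_weight p v x = +oo)%E.
    by apply/eqP; rewrite -leye_eq leNgt; apply/negP => fin; apply: ngC.
  have quo := le_lt_trans (quoK lC) (ltry K).
  have := testing_infinite p1 pq mu' u'0 uu' lC quo inf.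
  apply: filterS => x ux t' kn' [<- <-] _ _ xc.
  exact/ux/(cell_sub_cube L0).
by apply: filterS => x h t kn; apply: (h (pickle (t, kn))); rewrite pickleK.
Qed.

(** For almost every [x] with [u' x > 0] all admissible cells of [x] are good.
    If [s] is the sum over the grids of the majorants at [x], the averages of [f']
    over these cells are at most [(s / u' x) `^ q^-1], and so is the fractional
    integral up to a constant. Integration of the majorants concludes. *)
Lemma strong_type (f f' : Rvec R d -> R) (H : R) :
    measurable_fun setT f' -> {ae gamma, forall x, f x = f' x} ->
    (\int[gamma]_x (`|f' x| `^ p * v' x)%:E <= H%:E)%E ->
  (\int[gamma]_x (`|local_fractional_integral alpha a f x| `^ q * (u x)%:E) <=
    (strong_type_constant * H `^ (q / p))%:E)%E.
Proof.
move=> mf' ff' fH.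
have /choice[G GP] t :=
  grid_majorant L0 p1 pq K0 mu' u'0 uu' mv' v'0 vv' quoK mf' fH t.
have mG t : measurable_fun setT (G t) by have [] := GP t.
have G0 t x : (0 <= G t x)%E by have [] := GP t.
pose S x := (\sum_(t : {ffun 'I_d -> bool}) G t x)%E.
have S0 x : (0 <= S x)%E by exact: sume_ge0.
have intS : (\int[gamma]_x ((kappa `^ q)%:E * S x) <=
    (strong_type_constant * H `^ (q / p))%:E)%E.
  rewrite ge0_integralZl ?lee_fin ?powR_ge0//; last exact: emeasurable_sum.
  rewrite /strong_type_constant -mulrA EFinM lee_wpmul2l ?lee_fin ?powR_ge0//.
  rewrite ge0_integral_sum//.
  apply: (@le_trans _ _ (\sum_(t : {ffun 'I_d -> bool})
    (K `^ q * sawyer_constant p q * H `^ (q / p))%:E)%E).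
    by apply: lee_sum => t _; have [] := GP t.
  rewrite sumEFin sumr_const lee_fin -[leLHS]mulr_natl.
  by rewrite cardT -cardE !mulrA.
apply: le_trans intS; apply: le_integral_ae.
apply: filterS2 uu' infinite_cells => x -> inf _.
have := u'0 x; rewrite le_eqVlt => /predU1P[<-|u0].
  by rewrite mule0 mule_ge0// lee_fin powR_ge0.
have [Sy|Sfin] := eqVneq (S x) +oo%E.
  by rewrite Sy gt0_muley ?leey// lte_fin powR_gt0.
have Sf : S x \is a fin_num by rewrite ge0_fin_numE// lt_neqAle Sfin leey.
rewrite -(fineK Sf); set s := fine (S x); have s0 : 0 <= s by exact: fine_ge0.
pose B := (s / u' x) `^ q^-1.
have cellB t k : grid_side L k <= 3 * a * admissible x ->
    ((gauss_power beta (cell_cube L t (cell_of L t k x)))%:E *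
      \int[gamma]_(y in cell L t (cell_of L t k x)) `|f' y|%:E <= B%:E)%E.
  move=> small; have xc := cell_ofP L t k x.
  have lC := cube_local a0 ab (grid_side_gt0 L0 k) small (cell_sub_cube L0 xc).
  have gC : good_cell L p b v t (cell_of L t k x).
    apply: contrapT => ng; have := inf t _ lC ng xc.
    by move=> ux; rewrite ux ltxx in u0.
  have [_ _ _ lbG] := GP t; have := lbG _ _ gC xc.
  set X := (X in (X `^ q * _ <= _)%E) => XG; rewrite -/X.
  have X0 : (0 <= X)%E.
    rewrite mule_ge0 ?lee_fin ?powR_ge0//.
    by apply: integral_ge0 => y _; rewrite lee_fin.
  have Xq : (X `^ q <= (s / u' x)%:E)%E.
    rewrite EFinM lee_pdivlMr//; apply: (le_trans XG).
    by rewrite /s fineK// /S (bigD1 t)//= leeDl// sume_ge0.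
  rewrite /B -poweR_EFin -[X]poweRe1// -[1](@mulfV _ q) ?gt_eqF// poweRrM.
  apply: gt0_ler_poweR; rewrite ?invr_ge0 ?(ltW q0)// in_itv/= leey andbT ?poweR_ge0//.
  by rewrite lee_fin divr_ge0// ltW.
have B0 : 0 <= B by exact: powR_ge0.
have := local_fractional_integral_le a0 ba ad d0 mf' ff' B0 cellB.
set I := (`|_|)%E => IB.
have {}IB : (I <= (kappa * B)%:E)%E.
  by apply: (le_trans IB); rewrite lee_fin ler_wpM2r// /kappa lerDl.
apply: (@le_trans _ _ ((kappa * B)%:E `^ q * (u' x)%:E)%E).
  rewrite lee_wpmul2r ?lee_fin ?(ltW u0)//.
  apply: gt0_ler_poweR; rewrite ?(ltW q0)// in_itv/= leey andbT ?abse_ge0//.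
  by rewrite lee_fin mulr_ge0// ltW.
rewrite poweR_EFin -!EFinM lee_fin powRM ?(ltW kappa0)// /B -powRrM mulVf ?gt_eqF//.
by rewrite powRr1 ?divr_ge0 ?(ltW u0)// -mulrA divfK// gt_eqF.
Qed.

End strong_type.

Theorem theorem1p8 (R : realType) (d : nat) (a p q alpha : R)
    (u v : Rvec R d -> R) (a_gt0 : 0 < a) (p_gt1 : 1 < p) (pq : p <= q)
    (alpha_gt0 : 0 < alpha) (alpha_ltd : alpha < d%:R)
    (wu : weight u) (wv : weight v)
    (huv : exists b' beta' : R,
      [/\ 6 * a + 9 * Num.sqrt d%:R * a ^+ 2 < b', 0 < beta', beta' < alpha &
          local_testing p q beta' b' u v]) :
  exists C : R, 0 < C /\
    forall f : Rvec R d -> R, Lp_weighted p v f ->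
      ((\int[gauss_measure R d]_x
          (`|local_fractional_integral alpha a f x| `^ q * (u x)%:E)) `^ q^-1
       <= C%:E * (Lp_integral p v f) `^ p^-1)%E.
Proof.
have [b [beta [ab beta0 ba test]]] := huv.
have p0 : 0 < p by exact: lt_trans p_gt1.
have q0 : 0 < q by exact: lt_le_trans pq.
have [u' [mu' u'0 uu']] := weight_borel wu.
have [v' [mv' v'0 vv']] := weight_borel wv.
have [K [K0 quoK]] : exists K : R, 0 <= K /\ forall Q, local_cubes b Q ->
    (testing_quotient p q beta b u v Q <= K%:E)%E.
  move: test; rewrite /local_testing; set E := ereal_sup _ => Ey.
  have [K [K0 EK]] : exists K : R, 0 <= K /\ (E <= K%:E)%E.
    case: E Ey => [r _| //|_]; last by exists 0; rewrite leNye.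
    by exists (Num.max 0 r); rewrite lee_fin !le_max !lexx orbT.
  exists K; split => // Q lQ; apply: le_trans EK.
  by apply: ereal_sup_ubound; exists Q.
pose C0 := @strong_type_constant R d a p q alpha beta K.
have C00 : 0 <= C0.
  rewrite /C0 /strong_type_constant /sawyer_constant !mulr_ge0 ?powR_ge0//.
  - exact: ltW.
  - by rewrite invr_ge0 ltW.
exists ((C0 + 1) `^ q^-1); split; first by rewrite powR_gt0// ltr_wpDl.
move=> f [mf fLp].
have [f' [mf' ff']] := borel_modification mf.
have {}ff' := ae_gauss ff'.
have Lp' : (Lp_integral p v f =
    \int[gauss_measure R d]_x (`|f' x| `^ p * v' x)%:E)%E.
  by apply: eq_integral_ae; apply: filterS2 ff' vv' => x -> -> .
have Lp0 : (0 <= Lp_integral p v f)%E.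
  rewrite Lp'; apply: integral_ge0 => x _.
  by rewrite lee_fin mulr_ge0 ?powR_ge0.
have Lpf : Lp_integral p v f \is a fin_num by rewrite ge0_fin_numE.
rewrite -(fineK Lpf); set H := fine _; have H0 : 0 <= H by exact: fine_ge0.
have fH : (\int[gauss_measure R d]_x (`|f' x| `^ p * v' x)%:E <= H%:E)%E.
  by rewrite -Lp' fineK.
have main := strong_type a_gt0 p_gt1 pq alpha_gt0 alpha_ltd ab ba K0 mu' u'0 uu'
  mv' v'0 vv' quoK mf' ff' fH.
apply: (@le_trans _ _ (((C0 + 1) * H `^ (q / p))%:E `^ q^-1)%E).
  apply: gt0_ler_poweR; first by rewrite invr_ge0 ltW.
  - rewrite in_itv/= leey andbT.
    rewrite (@eq_integral_ae _ _ _ _ _ _ (fun x =>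
      `|local_fractional_integral alpha a f x| `^ q * (u' x)%:E)%E).
      by apply: integral_ge0 => x _; rewrite mule_ge0 ?poweR_ge0 ?lee_fin.
    by apply: filterS uu' => x ->.
  - by rewrite in_itv/= leey andbT lee_fin mulr_ge0 ?powR_ge0 ?addr_ge0.
  - by apply: (le_trans main); rewrite lee_fin ler_wpM2r ?powR_ge0// lerDl.
rewrite !poweR_EFin -EFinM lee_fin powRM ?powR_ge0 ?addr_ge0// -powRrM.
by rewrite mulrAC divff ?gt_eqF// mul1r.
Qed.
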